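(* For every positive integer $n$ and every $\varepsilon>0$ there is a number $N=N(n,\varepsilon)$, depending only on $n$ and $\varepsilon$, such that the following holds. Let $T\subset\mathbb{E}^m$ be a billiard table with $n$ convex walls $A_1,\ldots,A_n$ (in a Euclidean space of any dimension $m$). Assume that the walls have a common interior point and that all intersections of the walls have $\varepsilon$-wide corners. Then the number of collisions of any billiard trajectory in $T$ is at most $N$.
   Context: Billiard table with $n$ convex walls: $A_1,\ldots,A_n$ are closed convex bodies in $\mathbb{E}^m$, each with boundary $\partial A_i$ a smooth hypersurface; the table is $T=\overline{\mathbb{E}^m\setminus\bigcup_i A_i}$, and the sets $A_i$ are its walls. Trajectory: a billiard trajectory in $T$ is a unit-speed polygonal line in $T$ that follows the standard law of billiards at its break points on $\partial A_i$ (in particular the angle of reflection equals the angle of incidence). The break points are called collisions. It is assumed that a trajectory never meets a wall in a tangent direction and meets at most one wall in a small neighborhood of every time $t$. If the trajectory meets a wall tangentially at time $t$, or meets two or more walls at time $t$, or collisions accumulate at $t$, then the trajectory is declared to be undefined at times $\ge t$. $\varepsilon$-wide corners: a closed convex set $A\subset\mathbb{E}^m$ has $\varepsilon$-wide corners if for each point $p\in A$ the set $A$ contains a small right circular cone with tip $p$ and aperture $\varepsilon$ (the aperture is the maximum angle between two generating lines of the cone). All intersections of $A_1,\ldots,A_n$ have $\varepsilon$-wide corners if for every nonempty $F\subset\{1,\ldots,n\}$ the set $\bigcap_{i\in F}A_i$ has $\varepsilon$-wide corners. *)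

(* Defs.v *)
From HB Require Import structures.
From mathcomp Require Import all_boot all_order all_algebra.
From mathcomp Require Import all_classical all_reals all_analysis.

Set Implicit Arguments.
Unset Strict Implicit.
Unset Printing Implicit Defensive.

Import Order.TTheory GRing.Theory Num.Theory.
Import numFieldNormedType.Exports.

Local Open Scope classical_set_scope.
Local Open Scope ring_scope.

(* Euclidean space E^m is 'rV[R]_m. The library norm `|_| on 'rV[R]_m is the  *)
(* sup norm: it induces the right topology, but lengths and angles have to    *)
(* be measured with dotv and enorm.                                           *)

Definition dotv (R : realType) (m : nat) (u v : 'rV[R]_m) : R :=
  (u *m v^T) 0 0.

Definition enorm (R : realType) (m : nat) (u : 'rV[R]_m) : R :=
  Num.sqrt (dotv u u).

Definition boundary (T : topologicalType) (A : set T) : set T :=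
  closure A `\` interior A.

Definition partial (R : realType) (m : nat) (j : 'I_m)
    (f : 'rV[R]_m -> R^o) : 'rV[R]_m -> R^o :=
  fun x => 'D_(delta_mx 0 j) f x.

Definition grad (R : realType) (m : nat) (f : 'rV[R]_m -> R^o)
    (p : 'rV[R]_m) : 'rV[R]_m :=
  \row_j partial j f p.

(* f is of class C^k on U; meant for open U. *)
Fixpoint class_C (R : realType) (m : nat) (k : nat) (U : set 'rV[R]_m)
    (f : 'rV[R]_m -> R^o) : Prop :=
  (forall x, U x -> {for x, continuous f}) /\
  if k is k'.+1 then
    forall j : 'I_m, (forall x, U x -> derivable f x (delta_mx 0 j)) /\
                     class_C k' U (partial j f)
  else True.

Definition smooth_on (R : realType) (m : nat) (U : set 'rV[R]_m)
    (f : 'rV[R]_m -> R^o) : Prop :=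
  forall k, class_C k U f.

Definition local_equation (R : realType) (m : nat) (S : set 'rV[R]_m)
    (p : 'rV[R]_m) (f : 'rV[R]_m -> R^o) : Prop :=
  exists U, [/\ open_nbhs p U, smooth_on U f,
    (forall x, U x -> (S x <-> f x = 0)) & grad f p != 0].

Definition smooth_hypersurface (R : realType) (m : nat) (S : set 'rV[R]_m) :
    Prop :=
  forall p, S p -> exists f, local_equation S p f.

(* One of the two unit vectors orthogonal to the tangent hyperplane, which is *)
(* the kernel of the differential of a local equation.                        *)
Definition unit_normal (R : realType) (m : nat) (S : set 'rV[R]_m)
    (p nu : 'rV[R]_m) : Prop :=
  enorm nu = 1 /\
  exists2 f, local_equation S p f & exists c : R, grad f p = c *: nu.

Definition tangent_to (R : realType) (m : nat) (S : set 'rV[R]_m)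
    (p w : 'rV[R]_m) : Prop :=
  exists2 nu, unit_normal S p nu & dotv w nu = 0.

(* Boundedness is not required: half-spaces and cylinders are allowed walls.  *)
Definition convex_wall (R : realType) (m : nat) (A : set 'rV[R]_m) : Prop :=
  [/\ closed A, convex_set (A : set (convex_lmodType 'rV[R]_m)),
      interior A !=set0 & smooth_hypersurface (boundary A)].

Definition table (R : realType) (m n : nat) (A : 'I_n -> set 'rV[R]_m) :
    set 'rV[R]_m :=
  closure (~` \bigcup_i A i).

(* C is a solid right circular cone with tip p, unit axis a and height h; its *)
(* generating lines make the angle theta / 2 with the axis. There is no cone  *)
(* of aperture pi or more.                                                    *)
Definition right_circular_cone (R : realType) (m : nat) (p : 'rV[R]_m)
    (theta : R) (C : set 'rV[R]_m) : Prop :=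
  0 < theta < pi /\
  exists (a : 'rV[R]_m) (h : R), [/\ enorm a = 1, 0 < h &
    C = [set x | enorm (x - p) * cos (theta / 2) <= dotv (x - p) a <= h]].

Definition wide_corners (R : realType) (m : nat) (eps : R)
    (A : set 'rV[R]_m) : Prop :=
  forall p, A p -> exists2 C, right_circular_cone p eps C & C `<=` A.

(* A trajectory is a map g considered only on its time domain J. These two    *)
(* say that t is preceded (followed) in J by an interval of motion along a    *)
(* straight line with velocity u. They never hold at a left (right) endpoint. *)
Definition velocity_before (R : realType) (m : nat) (J : set R)
    (g : R -> 'rV[R]_m) (t : R) (u : 'rV[R]_m) : Prop :=
  \forall s \near t^'-, J s /\ g s = g t + (s - t) *: u.

Definition velocity_after (R : realType) (m : nat) (J : set R)
    (g : R -> 'rV[R]_m) (t : R) (u : 'rV[R]_m) : Prop :=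
  \forall s \near t^'+, J s /\ g s = g t + (s - t) *: u.

(* In particular the break points do not accumulate at a time of J; they may  *)
(* a priori accumulate at an endpoint of J that is not in J.                  *)
Definition unit_speed_polygonal (R : realType) (m : nat) (J : set R)
    (g : R -> 'rV[R]_m) : Prop :=
  forall t, J t ->
    ((exists2 s, J s & s < t) ->
       exists2 u, enorm u = 1 & velocity_before J g t u) /\
    ((exists2 s, J s & t < s) ->
       exists2 v, enorm v = 1 & velocity_after J g t v).

Definition break_point (R : realType) (m : nat) (J : set R)
    (g : R -> 'rV[R]_m) (t : R) (u v : 'rV[R]_m) : Prop :=
  [/\ J t, velocity_before J g t u, velocity_after J g t v & u != v].

(* Reflection in the tangent hyperplane of the hypersurface S at p. *)
Definition reflects (R : realType) (m : nat) (S : set 'rV[R]_m)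
    (p u v : 'rV[R]_m) : Prop :=
  S p /\ forall nu, unit_normal S p nu -> v = u - (2 * dotv u nu) *: nu.

(* The time domain J is an arbitrary interval, bounded or not, that contains  *)
(* its endpoints or not; a trajectory that becomes undefined at time t has    *)
(* its domain in ]-oo, t[.                                                    *)
Record billiard_trajectory (R : realType) (m n : nat)
    (A : 'I_n -> set 'rV[R]_m) (J : set R) (g : R -> 'rV[R]_m) : Prop := {
  trajectory_interval : is_interval J;
  trajectory_in_table : forall t, J t -> table A (g t);
  trajectory_polygonal : unit_speed_polygonal J g;
  trajectory_reflection : forall t u v, break_point J g t u v ->
    exists i, reflects (boundary (A i)) (g t) u v;
  trajectory_not_tangent : forall t i w, J t -> A i (g t) ->
    velocity_before J g t w \/ velocity_after J g t w ->
    ~ tangent_to (boundary (A i)) (g t) w;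
  trajectory_one_wall : forall t, J t -> exists2 d : R, 0 < d &
    forall s1 s2 i1 i2, J s1 -> J s2 -> `|s1 - t| < d -> `|s2 - t| < d ->
      A i1 (g s1) -> A i2 (g s2) -> i1 = i2
}.

Definition collisions (R : realType) (m : nat) (J : set R)
    (g : R -> 'rV[R]_m) : set R :=
  [set t | exists u v, break_point J g t u v].

(* Main.v *)
(* For p in a convex set contained in all walls that are hit, reflections can only
   increase the derivative of |g t - p|^2, so |g t - p|^2 - t^2 is convex: the
   trajectory g behaves like a geodesic of a CAT(0) space. Let K be the
   intersection of the walls that are hit, f t the distance from g t to K, and let
   the excess of an interval be its length minus the distance of the endpoints of
   the trajectory on it.

   Cut the trajectory at t_0 < t_1 < ... into blocks that hit all these walls. A
   wall hit shortly before and after t_j contains the chord between the two hits,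
   so the distance of g t_j to each wall is controlled by the excess, and wide
   corners turn this into
     f(t_j)^2 <= D (t_j - t_(j-1)) excess(t_(j-1), t_(j+1)),
   where D = 2 / sin(eps / 2)^2. Since f is convex, f >= f(t_0) after t_0 may be
   assumed, up to reversing time and dropping half of the blocks. The comparison
   with the nearest point of K to g t_0 then gives, for t_0 < s < t,
     excess(t_0, t) (t - t_0) <= 2 f(t_0) f(t),
     excess(s, t) (s - t_0) <= f(t_0) f(s).
   Summing the first estimate over the blocks shows that f(t_k) / f(t_0) grows at
   least linearly in k, while the second one and the convexity of f show that
   f(t_(k+1)) / f(t_0) <= 2 D once f(t_k) >= 2 f(t_0). So the number of blocks is
   bounded in terms of D, and induction on the number of walls that are hit
   bounds the number of collisions. *)

Require Import Defs.
From HB Require Import structures.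
From mathcomp Require Import all_boot all_order all_algebra.
From mathcomp Require Import all_classical all_reals all_analysis.
From mathcomp Require Import ring lra zify.

Set Implicit Arguments.
Unset Strict Implicit.
Unset Printing Implicit Defensive.

Import Order.TTheory GRing.Theory Num.Theory.
Import numFieldNormedType.Exports.

Local Open Scope classical_set_scope.
Local Open Scope ring_scope.

(** * Euclidean geometry *)

Section Vectors.
Context {R : realType} {m : nat}.
Implicit Types (u v w x p : 'rV[R]_m) (a b t : R).

Lemma dotvE u v : dotv u v = \sum_j u 0 j * v 0 j.
Proof. by rewrite /dotv !mxE; apply: eq_bigr => j _; rewrite mxE. Qed.

Lemma dotvC u v : dotv u v = dotv v u.
Proof. by rewrite !dotvE; apply: eq_bigr => j _; rewrite mulrC. Qed.

Lemma dotvDl u v w : dotv (u + v) w = dotv u w + dotv v w.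
Proof. by rewrite /dotv mulmxDl mxE. Qed.

Lemma dotvZl a u w : dotv (a *: u) w = a * dotv u w.
Proof. by rewrite /dotv -scalemxAl mxE. Qed.

Lemma dotvNl u w : dotv (- u) w = - dotv u w.
Proof. by rewrite -scaleN1r dotvZl mulN1r. Qed.

Lemma dotvDr w u v : dotv w (u + v) = dotv w u + dotv w v.
Proof. by rewrite ![dotv w _]dotvC dotvDl. Qed.

Lemma dotvZr a w u : dotv w (a *: u) = a * dotv w u.
Proof. by rewrite ![dotv w _]dotvC dotvZl. Qed.

Lemma dotvNr w u : dotv w (- u) = - dotv w u.
Proof. by rewrite ![dotv w _]dotvC dotvNl. Qed.

Definition dotv_lin := (dotvDl, dotvDr, dotvZl, dotvZr, dotvNl, dotvNr).

Lemma dotvv_ge0 u : 0 <= dotv u u.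
Proof. by rewrite dotvE sumr_ge0// => j _; rewrite -expr2 sqr_ge0. Qed.

Lemma dotvv_eq0 u : (dotv u u == 0) = (u == 0).
Proof.
apply/eqP/eqP => [|->]; last by rewrite dotvE big1// => j _; rewrite mxE mul0r.
rewrite dotvE => /eqP; rewrite psumr_eq0; last first.
  by move=> j _; rewrite -expr2 sqr_ge0.
move=> /allP u0; apply/rowP => j; rewrite mxE.
by have := u0 j (mem_index_enum _); rewrite /= mulf_eq0 orbb => /eqP.
Qed.

Lemma enorm_ge0 u : 0 <= enorm u.
Proof. exact: sqrtr_ge0. Qed.

Lemma sqr_enorm u : enorm u ^+ 2 = dotv u u.
Proof. by rewrite sqr_sqrtr// dotvv_ge0. Qed.

Lemma enorm_eq0 u : (enorm u == 0) = (u == 0).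
Proof. by rewrite -dotvv_eq0 -sqr_enorm sqrf_eq0. Qed.

Lemma enorm0 : enorm (0 : 'rV[R]_m) = 0.
Proof. by apply/eqP; rewrite enorm_eq0. Qed.

Lemma enorm_le u b : 0 <= b -> dotv u u <= b ^+ 2 -> enorm u <= b.
Proof. by move=> b0; rewrite -sqr_enorm ler_sqr// nnegrE enorm_ge0. Qed.

Lemma enormN u : enorm (- u) = enorm u.
Proof. by rewrite /enorm !dotv_lin opprK. Qed.

Lemma enormB u v : enorm (u - v) = enorm (v - u).
Proof. by rewrite -enormN opprB. Qed.

Lemma enormZ a u : enorm (a *: u) = `|a| * enorm u.
Proof.
by rewrite /enorm !dotv_lin mulrA -expr2 sqrtrM ?sqr_ge0// sqrtr_sqr.
Qed.

(** Cauchy-Schwarz: the squared length of [dotv v v *: u - dotv u v *: v] is [dotv v v] times the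
    Gram determinant of [u] and [v]. *)
Lemma dotv_le u v : dotv u v <= enorm u * enorm v.
Proof.
have [v0|v0] := eqVneq v 0.
  by rewrite v0 enorm0 mulr0 dotvE big1// => j _; rewrite mxE mulr0.
have vv : 0 < dotv v v by rewrite lt_def dotvv_ge0 dotvv_eq0 v0.
have := dotvv_ge0 (dotv v v *: u - dotv u v *: v).
rewrite !dotv_lin (dotvC v u) => H.
have {}H : dotv u v ^+ 2 <= dotv u u * dotv v v.
  rewrite -subr_ge0 -(pmulr_rge0 _ vv).
  by apply: le_trans H _; rewrite le_eqVlt; apply/orP; left; apply/eqP; ring.
rewrite -!sqr_enorm -exprMn in H.
apply: le_trans (ler_norm _) _; rewrite -ler_sqr ?nnegrE ?normr_ge0 ?mulr_ge0 ?enorm_ge0//.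
by rewrite real_normK// num_real.
Qed.

Lemma enormD u v : enorm (u + v) <= enorm u + enorm v.
Proof.
apply: enorm_le; first by rewrite addr_ge0 ?enorm_ge0.
rewrite !dotv_lin (dotvC v u) sqrrD !sqr_enorm.
have := dotv_le u v; lra.
Qed.

Lemma enorm_triangle w u v : enorm (u - v) <= enorm (u - w) + enorm (w - v).
Proof. by have := enormD (u - w) (w - v); rewrite addrA subrK. Qed.

Lemma norm_coord_le u j : `|u 0 j| <= `|u|.
Proof. by rewrite /Num.Def.normr/= mx_normrE; apply: (le_bigmax _ (fun i => `|u i.1 i.2|) (0, j)). Qed.

Lemma norm_le_enorm u : `|u| <= enorm u.
Proof.
rewrite {1}/Num.Def.normr/= mx_normrE; apply: bigmax_le => [|[i j] _ /=].
  exact: enorm_ge0.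
rewrite (ord1 i) -sqrtr_sqr ler_sqrt ?dotvv_ge0// dotvE (bigD1 j)//= -expr2.
by rewrite lerDl sumr_ge0// => k _; rewrite -expr2 sqr_ge0.
Qed.

(** The sup norm carries the topology, the Euclidean norm the geometry. The crude constant [m + 1]
    is positive also for [m = 0], so one can divide by it. *)
Lemma enorm_le_norm u : enorm u <= (m%:R + 1) * `|u|.
Proof.
apply: enorm_le; first by rewrite mulr_ge0// addr_ge0.
rewrite dotvE; apply: (@le_trans _ _ (\sum_(j < m) `|u| ^+ 2)).
  apply: ler_sum => j _; apply: le_trans (ler_norm _) _.
  by rewrite normrM expr2 ler_pM// norm_coord_le.
rewrite sumr_const card_ord -[_ *+ m]mulr_natl exprMn.
rewrite ler_wpM2r ?sqr_ge0//; have := ler0n R m; nra.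
Qed.

Lemma enorm_continuous (p : 'rV[R]_m) : continuous (fun x : 'rV[R]_m => enorm (p - x)).
Proof.
move=> x; have F : Filter (nbhs (x : 'rV[R]_m)) by exact: nbhs_pfilter.
apply/cvgrPdist_lt => e e0.
have m1 : 0 < m%:R + 1 :> R by rewrite ltr_pwDr.
apply/(@nbhs_ballP _ 'rV[R]_m); exists (e / (m%:R + 1)) => /=; first exact: divr_gt0.
move=> y; rewrite -ball_normE /ball_ /= ltr_pdivlMr// mulrC => xy.
have {}xy := le_lt_trans (enorm_le_norm _) xy.
apply: le_lt_trans xy; rewrite ler_norml.
have := enorm_triangle x p y; have := enorm_triangle y p x.
rewrite (enormB y x); lra.
Qed.
(** Only the points of [K] in the closed Euclidean ball about [x] through a given [q] in [K]
    compete; this piece of [K] is compact, since the sup norm is at most the Euclidean one. *)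
Lemma nearest_point_exists (K : set 'rV[R]_m) (x : 'rV[R]_m) : closed K -> K !=set0 ->
  exists2 p, K p & forall z, K z -> enorm (x - p) <= enorm (x - z).
Proof.
move=> Kc [q Kq]; pose r := enorm (x - q).
pose B := [set z : 'rV[R]_m | enorm (x - z) <= r].
have Bc : closed B.
  apply: (@preimage_closed _ _ (fun z : 'rV[R]_m => enorm (x - z)) [set y | y <= r]).
    by move=> z _; exact: enorm_continuous.
  exact: closed_le.
have [| | |p] := @EVT_min_rV R m (fun z => enorm (x - z)) (K `&` B).
- by exists q; split => //; rewrite /B/=.
- apply: bounded_closed_compact; last exact: closedI.
  exists (`|x| + r); split; first exact: num_real.
  move=> M rM z [_ Bz]; apply: ltW; apply: le_lt_trans rM.
  have H := norm_le_enorm (x - z); have := ler_distD x 0 z.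
  rewrite !sub0r !normrN => /le_trans; apply.
  by rewrite lerD2l (le_trans H).
- by apply: continuous_subspaceT => z; exact: enorm_continuous.
- rewrite inE => -[Kp Bp] pmin; exists p => // z Kz.
  have [zr|/ltW rz] := leP (enorm (x - z)) r; last exact: le_trans rz.
  by apply: pmin; rewrite inE.
Qed.

End Vectors.

(** * Convex sets, projections and wide corners *)

Section Convexity.
Context {R : realType} {m : nat}.
Implicit Types (x y z p a : 'rV[R]_m) (A K : set 'rV[R]_m).

Definition segment_closed A :=
  forall x y t, A x -> A y -> 0 <= t <= 1 -> A (x + t *: (y - x)).

Lemma convex_set_segment A :
  convex_set (A : set (convex_lmodType 'rV[R]_m)) -> segment_closed A.
Proof.
move=> cA x y t Ax Ay /andP[t0 t1].
have := cA y x (Itv01 t0 t1) (mem_set Ay) (mem_set Ax).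
rewrite inE; suff -> : conv (Itv01 t0 t1) (y : convex_lmodType 'rV[R]_m) x =
  x + t *: (y - x) by [].
transitivity (t *: y + (1 - t) *: x); first by [].
by apply/rowP => j; rewrite !mxE; ring.
Qed.

Lemma segment_closed_bigcap (I : Type) (F : set I) (B : I -> set 'rV[R]_m) :
  (forall i, F i -> segment_closed (B i)) -> segment_closed (\bigcap_(i in F) B i).
Proof. by move=> cB x y t Bx By t01 i Fi; apply: cB => //; [exact: Bx|exact: By]. Qed.

(** The nearest point is encoded by its variational inequality, an obtuse angle at [p] towards every
    point of [K]. *)
Definition projects_to K x p := K p /\ forall z, K z -> dotv (x - p) (z - p) <= 0.

Lemma nearest_projects_to K x p : segment_closed K -> K p ->
  (forall z, K z -> enorm (x - p) <= enorm (x - z)) -> projects_to K x p.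
Proof.
move=> cK Kp pmin; split=> // z Kz; rewrite leNgt; apply/negP => dp.
pose D := dotv (x - p) (z - p); pose Q := dotv (z - p) (z - p).
have Q0 : 0 <= Q := dotvv_ge0 _.
(* A step of this size from [p] towards [z] changes the squared distance by
   [t^2 Q - 2 t D = - t D - t^2 D < 0]; it makes sense even if [Q = 0]. *)
pose t := D / (D + Q).
have t0 : 0 < t by rewrite divr_gt0// ltr_wpDr.
have t1 : t <= 1 by rewrite ler_pdivrMr ?mul1r ?lerDl// ltr_wpDr.
have := pmin _ (cK _ _ _ Kp Kz (introT andP (conj (ltW t0) t1))).
rewrite -ler_sqr ?nnegrE ?enorm_ge0// !sqr_enorm opprD addrA.
rewrite [X in _ <= X](_ : _ = dotv (x - p) (x - p) - 2 * t * D + t ^+ 2 * Q); last first.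
  by rewrite /D /Q; move: (x - p) (z - p) => u v; rewrite !dotv_lin (dotvC v u); ring.
have tDQ : t * (D + Q) = D by rewrite divfK// gt_eqF// ltr_wpDr.
have : 0 < t * D by rewrite mulr_gt0.
have := mulr_ge0 (sqr_ge0 t) (ltW dp); rewrite -/D => h1 h2 h3.
have e : t ^+ 2 * Q = t * D - t ^+ 2 * D by have := congr1 ( *%R t) tDQ; rewrite /=; lra.
by rewrite e in h3; lra.
Qed.

Lemma projection_exists K x : closed K -> segment_closed K -> K !=set0 ->
  exists p, projects_to K x p.
Proof.
move=> cK sK K0; have [p Kp pmin] := nearest_point_exists x cK K0.
by exists p; exact: nearest_projects_to.
Qed.

(* The ball is inscribed in the infinite cone; only the height of the cone forces
   [s] to be small. *)
Lemma cone_contains_ball p theta C : right_circular_cone p theta C ->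
  0 < sin (theta / 2) /\
  exists a s, [/\ enorm a = 1, 0 < s &
    forall w, enorm w <= s * sin (theta / 2) -> C (p + s *: a + w)].
Proof.
move=> [/andP[th0 thpi] [a [h [a1 h0 ->]]]].
have d0 : 0 < sin (theta / 2) by apply: sin_gt0_pi; rewrite ?divr_gt0//; lra.
split=> //; set d := sin _ in d0 *; set c := cos _.
have d1 : d <= 1 by exact: sin_le1.
have cd : c ^+ 2 = 1 - d ^+ 2 by rewrite -(cos2Dsin2 (theta / 2)) -/c -/d addrK.
have aa : dotv a a = 1 by rewrite -sqr_enorm a1 expr1n.
exists a, (h / 2); split=> [//||w wd]; first by rewrite divr_gt0.
set s := h / 2 in wd *; have s0 : 0 < s by rewrite divr_gt0.
have wa : `|dotv w a| <= s * d.
  rewrite ler_norml; apply/andP; split; last first.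
    by apply: le_trans (dotv_le _ _) _; rewrite a1 mulr1.
  rewrite lerNl -dotvNl; apply: le_trans (dotv_le _ _) _.
  by rewrite a1 mulr1 enormN.
have ww : dotv w w <= (s * d) ^+ 2.
  by rewrite -sqr_enorm ler_sqr ?nnegrE ?enorm_ge0 ?mulr_ge0// ltW.
rewrite /=.
have -> : p + s *: a + w - p = s *: a + w by apply/rowP => j; rewrite !mxE; ring.
set b := dotv w a in wa; move: wa; rewrite ler_norml => /andP[wa1 wa2].
have e1 : dotv (s *: a + w) a = s + b by rewrite !dotv_lin aa mulr1.
have sd : s * d <= s by rewrite ler_piMr// ltW.
rewrite e1; apply/andP; split; last by rewrite /s in sd wa2 *; lra.
apply: le_trans (ler_norm _) _; rewrite -(ger0_norm (_ : 0 <= s + b)); last lra.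
rewrite -ler_sqr ?nnegrE ?normr_ge0// !real_normK ?num_real// exprMn sqr_enorm cd.
rewrite !dotv_lin aa (dotvC a w) -/b mulr1.
(* Once [dotv w w] is replaced by its bound [(s d)^2], the two sides of the cone condition differ by
   exactly this square. *)
have := sqr_ge0 (b + s * d ^+ 2).
have : 0 <= (1 - d ^+ 2) * ((s * d) ^+ 2 - dotv w w).
  by rewrite mulr_ge0// subr_ge0// expr_le1// ltW.
nra.
Qed.

(* With [p + s a] the centre of a ball of radius [s sin (theta / 2)] in the
   intersection, the point [t x + (1 - t) (p + s a)] lies in every [B i] when
   [t d = (1 - t) s sin (theta / 2)]; as [p] is nearest to [x], it makes an obtuse
   angle with [x] at [p], which bounds [|x - p|]. *)
Lemma wide_corner_error_bound (I : Type) (F : set I) (B : I -> set 'rV[R]_m)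
    theta x p d :
  (forall i, F i -> segment_closed (B i)) ->
  wide_corners theta (\bigcap_(i in F) B i) ->
  projects_to (\bigcap_(i in F) B i) x p ->
  (forall i, F i -> exists2 y, B i y & enorm (x - y) <= d) -> 0 <= d ->
  sin (theta / 2) * enorm (x - p) <= d.
Proof.
(* Working with [D = d + e] for arbitrary [e > 0] keeps [1 - t] positive also when [d = 0]. *)
move=> cB wB [Bp pvar] near d0; apply/ler_addgt0Pr => e e0.
have {}near i (Fi : F i) : exists2 y, B i y & enorm (x - y) <= d + e.
  by have [y By xy] := near i Fi; exists y => //; apply: le_trans xy _; rewrite lerDl ltW.
have {d0} : 0 < d + e by rewrite ltr_wpDl.
move: (d + e) near => {e e0}D near D0.
have [C /cone_contains_ball[] de0 [a [s [a1 s0 ball]]] CB] := wB p Bp.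
set de := sin _ in de0 ball *.
have sd0 : 0 < s * de by rewrite mulr_gt0.
have DS : 0 < D + s * de by rewrite addr_gt0.
pose t := s * de / (D + s * de).
have t1E : 1 - t = D / (D + s * de) by rewrite /t; field; rewrite gt_eqF.
have t0 : 0 < t by rewrite divr_gt0.
have t1 : 0 < 1 - t by rewrite t1E divr_gt0.
have Bz : (\bigcap_(i in F) B i) (x + (1 - t) *: (p + s *: a - x)).
  move=> i Fi; have [y By xy] := near i Fi.
  (* With this [w], the point to be placed in [B i] is the convex combination of [y] and
     [p + s a + w] with weights [t] and [1 - t]. *)
  pose w := (t / (1 - t)) *: (x - y).
  have wd : enorm w <= s * de.
    rewrite enormZ ger0_norm; last exact: divr_ge0 (ltW t0) (ltW t1).
    have -> : t / (1 - t) = s * de / D.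
      by rewrite t1E /t; field; rewrite !gt_eqF.
    by rewrite mulrAC ler_pdivrMr// ler_wpM2l// ltW.
  have Bc : B i (p + s *: a + w) by exact: (CB _ (ball _ wd) i Fi).
  have := cB i Fi _ _ (1 - t) By Bc; rewrite (ltW t1) gerBl (ltW t0).
  move=> /(_ isT); congr (B i _).
  apply/rowP => j; rewrite /w !mxE; field; exact: lt0r_neq0.
have := pvar _ Bz.
have -> : x + (1 - t) *: (p + s *: a - x) - p = ((1 - t) * s) *: a + t *: (x - p).
  by apply/rowP => j; rewrite !mxE; ring.
have := dotv_le (- (x - p)) a; rewrite dotvNl enormN a1 mulr1 lerNl => xa.
rewrite dotvDr !dotvZr -sqr_enorm.
have := enorm_ge0 (x - p); rewrite le_eqVlt => /orP[/eqP <- _|n0].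
  by rewrite mulr0 ltW.
move=> H; have {}H : t * enorm (x - p) * enorm (x - p) <= (1 - t) * s * enorm (x - p).
  have : (1 - t) * s * - enorm (x - p) <= (1 - t) * s * dotv (x - p) a.
    by rewrite ler_wpM2l// mulr_ge0 ?(ltW t1) ?(ltW s0).
  by move: H; rewrite expr2; lra.
move: H; rewrite ler_pM2r// t1E /t.
rewrite (_ : s * de / _ * _ = s * (de * enorm (x - p)) / (D + s * de)); last by field; rewrite gt_eqF.
rewrite (_ : D / _ * s = s * D / (D + s * de)); last by field; rewrite gt_eqF.
by rewrite ler_pM2r ?invr_gt0// ler_pM2l.
Qed.

End Convexity.

(** * Growth of the distance to the common part of the walls *)

Section Growth.
Context {R : realType}.

Lemma increasing_prefix_le (t : nat -> R) (M : nat) :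
  (forall j, (j < M)%N -> t j < t j.+1) ->
  forall i j, (i <= j <= M)%N -> t i <= t j.
Proof.
move=> tS i j; elim: j => [|j IH]; first by rewrite leqn0 => /andP[/eqP ->].
rewrite leq_eqVlt => /andP[/predU1P[->//|ij jM]].
by apply: (@le_trans _ _ (t j)); [apply: IH; rewrite -ltnS ij ltnW | exact/ltW/tS].
Qed.

(* [f j] will be the distance to the common part of the walls at time [t j] and
   [E i j] the excess of the trajectory between the times [t i] and [t j]. *)
Lemma bounded_growth (D : R) (t f : nat -> R) (E : nat -> nat -> R) (k : nat) :
  0 < D -> (0 < k)%N -> (forall j, (j < k.+2)%N -> t j < t j.+1) ->
  0 < f 0%N -> (forall j, (j <= k)%N -> f 0%N <= f j) ->
  0 <= E 0%N k -> 0 <= E k k.+2 ->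
  (forall j, (j <= k)%N -> f j.+1 ^+ 2 <= D * (t j.+1 - t j) * E j j.+2) ->
  (forall j, (j.+1 < k)%N -> E j j.+2 <= E 0%N k) ->
  E 0%N k * (t k - t 0%N) <= 2 * f 0%N * f k ->
  E k k.+2 * (t k - t 0%N) <= f 0%N * f k ->
  (f k - f 0%N) * (t k.+1 - t 0%N) <= (f k.+1 - f 0%N) * (t k - t 0%N) ->
  k.-1%:R <= 4 * D ^+ 2 + 4 * D.
Proof.
move=> D0 k0 tS f0 fmin E0 Ek h1 h2 h3 h4 h5.
have tle := increasing_prefix_le tS.
have T0 : 0 < t k - t 0%N by rewrite subr_gt0 (lt_le_trans (tS 0%N _))// tle//; clear -k0; lia.
have tk : t k < t k.+1 by apply: tS.
(* The estimates [h1] are added up: each contributes at least [f 0 ^+ 2], and each excess is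
   replaced by the total one. Since [h2] covers only pairs of blocks that end by [k], the sum stops
   at [k.-1]. *)
have sum j : (j < k)%N -> j%:R * f 0%N ^+ 2 <= D * E 0%N k * (t j - t 0%N).
  elim: j => [|j IH] jk; first by rewrite subrr mul0r mulr0.
  have tj : t j < t j.+1 by apply: tS; clear -jk; lia.
  have f1 : f 0%N ^+ 2 <= f j.+1 ^+ 2.
    have fj := fmin j.+1 (ltnW jk).
    by rewrite ler_sqr// nnegrE ?(le_trans (ltW f0) fj)// ltW.
  have := h1 j (ltnW (ltnW jk)).
  have : D * (t j.+1 - t j) * E j j.+2 <= D * (t j.+1 - t j) * E 0%N k.
    by rewrite ler_wpM2l ?h2// mulr_ge0 ?(ltW D0)// subr_ge0 ltW.
  have := IH (ltnW jk); rewrite -natr1; nra.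
have growth : k.-1%:R * f 0%N <= 2 * D * f k.
  have kk : (k.-1 < k)%N by rewrite prednK.
  have H1 := sum _ kk.
  have H2 : D * E 0%N k * (t k.-1 - t 0%N) <= D * E 0%N k * (t k - t 0%N).
    by rewrite ler_wpM2l ?mulr_ge0 ?(ltW D0)// lerD2r tle//; clear; lia.
  have H3 : D * (E 0%N k * (t k - t 0%N)) <= D * (2 * f 0%N * f k) by rewrite ler_pM2l.
  rewrite -(ler_pM2r f0); lra.
rewrite leNgt; apply/negP => kbig.
(* The assumed lower bound on [k.-1] is [2 D (2 D + 2)]. The factor [2 D + 2] is at least 2, as
   needed for [A1], and exceeds [2 D], which gives the final contradiction. *)
have fk : (2 * D + 2) * f 0%N < f k.
  rewrite -(ltr_pM2l (_ : 0 < 2 * D)); last by rewrite mulr_gt0.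
  apply: lt_le_trans growth; rewrite mulrA ltr_pM2r//; apply: le_lt_trans kbig; lra.
have T1 : t k - t 0%N <= t k.+1 - t 0%N by rewrite lerD2r ltW.
have Df0 : 0 < D * f 0%N by rewrite mulr_gt0.
have fk1 : f k <= f k.+1.
  rewrite -(lerD2r (- f 0%N)) -(ler_pM2r T0); apply: le_trans h5.
  by rewrite ler_wpM2l//; nra.
have T2 : 0 < t k.+1 - t 0%N := lt_le_trans T0 T1.
have fk0 : 0 < f k by nra.
have A1 : f k * (t k.+1 - t 0%N) <= 2 * f k.+1 * (t k - t 0%N).
  have : 0 <= (f k - 2 * f 0%N) * (t k.+1 - t 0%N).
    by rewrite mulr_ge0 ?(ltW T2)//; nra.
  have : 0 <= f 0%N * (t k - t 0%N) by rewrite mulr_ge0 ?ltW.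
  nra.
have A2 : f k.+1 ^+ 2 * (t k - t 0%N) <= D * (t k.+1 - t 0%N) * (f 0%N * f k).
  have B1 := h1 k (leqnn k).
  have B2 : D * (t k.+1 - t k) * E k k.+2 <= D * (t k.+1 - t 0%N) * E k k.+2.
    by rewrite ler_wpM2r// ler_pM2l// lerD2l lerN2 tle//; clear; lia.
  have B3 : D * (t k.+1 - t 0%N) * (E k k.+2 * (t k - t 0%N)) <=
            D * (t k.+1 - t 0%N) * (f 0%N * f k).
    by rewrite ler_wpM2l// mulr_ge0 ?ltW.
  apply: le_trans B3; rewrite mulrA ler_pM2r//; exact: le_trans B2.
have A3 : D * f 0%N * (f k * (t k.+1 - t 0%N)) <=
          D * f 0%N * (2 * f k.+1 * (t k - t 0%N)) by rewrite ler_pM2l.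
have F0 : 0 < f k.+1 := lt_le_trans fk0 fk1.
(* [A2] and [A3] combine; cancelling the common factor leaves [f k.+1 <= 2 D f 0], against [fk] and
   [fk1]. *)
have : f k.+1 * (f k.+1 * (t k - t 0%N)) <= 2 * D * f 0%N * (f k.+1 * (t k - t 0%N)) by lra.
rewrite ler_pM2r ?mulr_gt0//; nra.
Qed.

End Growth.

(** * Comparison with geodesics of a CAT(0) space *)

Section Comparison.
Context {R : realType} {m : nat}.
Implicit Types (g : R -> 'rV[R]_m) (K B : set 'rV[R]_m) (p : 'rV[R]_m).
Implicit Types (a b s t x y z : R).

Definition nonexpanding_on a b g :=
  forall s t, a <= s -> s <= t -> t <= b -> enorm (g t - g s) <= t - s.

(* The CAT(0) comparison inequality between [p] and three points of a unit
   speed geodesic; equivalently, [|g t - p| ^ 2 - t ^ 2] is convex in [t]. *)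
Definition comparison_on a b g p :=
  forall x y z, a <= x -> x < y -> y < z -> z <= b ->
    dotv (g y - p) (g y - p) * (z - x) + (z - y) * (y - x) * (z - x) <=
    dotv (g x - p) (g x - p) * (z - y) + dotv (g z - p) (g z - p) * (y - x).

Definition excess g s t := t - s - enorm (g t - g s).

Lemma projects_to_le K (x p z : 'rV[R]_m) : projects_to K x p -> K z ->
  enorm (x - p) <= enorm (x - z).
Proof.
move=> [Kp pvar] Kz; rewrite -ler_sqr ?nnegrE ?enorm_ge0// !sqr_enorm.
have := pvar z Kz; have -> : x - z = x - p - (z - p) by apply/rowP => j; rewrite !mxE; ring.
have := dotvv_ge0 (z - p); move: (x - p) (z - p) => u v.
rewrite !dotv_lin (dotvC v u); lra.
Qed.

Lemma nonexpanding_onS a b a' b' g : a <= a' -> b' <= b ->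
  nonexpanding_on a b g -> nonexpanding_on a' b' g.
Proof. by move=> aa bb gab s t *; apply: gab => //; [exact: le_trans aa _|exact: le_trans bb]. Qed.

Lemma comparison_onS a b a' b' g p : a <= a' -> b' <= b ->
  comparison_on a b g p -> comparison_on a' b' g p.
Proof. by move=> aa bb gab x y z *; apply: gab => //; [exact: le_trans aa _|exact: le_trans bb]. Qed.

Lemma excess_ge0 a b g s t : nonexpanding_on a b g -> a <= s -> s <= t -> t <= b ->
  0 <= excess g s t.
Proof. by move=> gab *; rewrite subr_ge0; exact: gab. Qed.

(** Triangle inequality through [g s] and [g t]: the two outer pieces have nonnegative excess. *)
Lemma excess_le a b g s t : nonexpanding_on a b g -> a <= s -> s <= t -> t <= b ->
  excess g s t <= excess g a b.
Proof.
move=> gab as_ st tb; rewrite /excess.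
have := gab a s (lexx _) as_ (le_trans st tb).
have := gab t b (le_trans as_ st) tb (lexx _).
have := enorm_triangle (g t) (g b) (g a); have := enorm_triangle (g s) (g t) (g a).
lra.
Qed.

(** Take the point dividing the chord in the ratio [l] in which [t] divides [[a, b]]. Stewart's
    theorem bounds the squared distance by [l (1 - l) ((b - a)^2 - G^2)], where [G] is the length of
    the chord, and one factor [b - a + G] is at most [2 (b - a)]. *)
Lemma near_chord a b g B t : nonexpanding_on a b g -> a <= t -> t <= b -> a < b ->
  segment_closed B -> B (g a) -> B (g b) ->
  exists2 y, B y & enorm (g t - y) ^+ 2 <= 2 * (t - a) * excess g a b.
Proof.
move=> gab at_ tb ab cB Ba Bb; pose l := (t - a) / (b - a).
have L0 : 0 < b - a by rewrite subr_gt0.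
have l0 : 0 <= l by rewrite divr_ge0 ?subr_ge0// ltW.
have l1 : l <= 1 by rewrite ler_pdivrMr// mul1r lerD2r.
have l1' : 0 <= 1 - l by rewrite subr_ge0.
have lE : l * (b - a) = t - a by rewrite divfK// gt_eqF.
exists (g a + l *: (g b - g a)); first by apply: cB => //; apply/andP.
have Ha := gab a t (lexx _) at_ tb; have Hb := gab t b at_ tb (lexx _).
rewrite enormB in Hb.
have {}Ha : dotv (g t - g a) (g t - g a) <= (t - a) ^+ 2.
  by rewrite -sqr_enorm ler_sqr ?nnegrE ?enorm_ge0 ?subr_ge0.
have {}Hb : dotv (g t - g b) (g t - g b) <= (b - t) ^+ 2.
  by rewrite -sqr_enorm ler_sqr ?nnegrE ?enorm_ge0 ?subr_ge0.
have e0 := excess_ge0 gab (lexx _) (ltW ab) (lexx _).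
have G0 := enorm_ge0 (g b - g a).
have bound : dotv (g t - (g a + l *: (g b - g a))) (g t - (g a + l *: (g b - g a)))
    <= l * (1 - l) * ((b - a) ^+ 2 - enorm (g b - g a) ^+ 2).
  rewrite sqr_enorm.
  have -> : dotv (g t - (g a + l *: (g b - g a))) (g t - (g a + l *: (g b - g a))) =
      (1 - l) * dotv (g t - g a) (g t - g a) + l * dotv (g t - g b) (g t - g b)
      - l * (1 - l) * dotv (g b - g a) (g b - g a).
    rewrite !dotv_lin; move: (g a) (g b) (g t) => u v w.
    by rewrite (dotvC w u) (dotvC w v) (dotvC v u); ring.
  have h1 := ler_wpM2l l1' Ha; have h2 := ler_wpM2l l0 Hb.
  have tE : t = a + l * (b - a) by rewrite lE addrC subrK.
  move: (dotv (g b - g a) _) (dotv (g t - g a) _) (dotv (g t - g b) _) h1 h2 => q1 q2 q3.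
  have -> : (t - a) ^+ 2 = l ^+ 2 * (b - a) ^+ 2 by rewrite -exprMn lE.
  have -> : (b - t) ^+ 2 = (1 - l) ^+ 2 * (b - a) ^+ 2.
    by rewrite -exprMn mulrBl lE; congr (_ ^+ 2); ring.
  by clear; lra.
rewrite sqr_enorm; apply: le_trans bound _.
rewrite /excess in e0 *; move: (enorm _) e0 G0 => G e0 G0.
have -> : (b - a) ^+ 2 - G ^+ 2 = (b - a - G) * (b - a + G) by ring.
apply: (@le_trans _ _ (l * (1 - l) * ((b - a - G) * (2 * (b - a))))).
  apply: ler_wpM2l; first exact: mulr_ge0.
  by apply: ler_wpM2l => //; lra.
rewrite -lE; have : 0 <= l * l * ((b - a - G) * (b - a)).
  by apply: mulr_ge0; [exact: mulr_ge0|exact: mulr_ge0 e0 (ltW L0)].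
by clear; lra.
Qed.

(** The comparison inequality is applied at the point dividing [[px, pz]] as [y] divides [[x, z]].
    Its quadratic term absorbs the squared distance of [g x] and [g z], since [g] is nonexpanding,
    and Cauchy-Schwarz for [g x - px] and [g z - pz] does the rest. *)
Lemma distance_convex a b g K x y z px py pz :
  segment_closed K -> nonexpanding_on a b g ->
  (forall p, K p -> comparison_on a b g p) ->
  projects_to K (g x) px -> projects_to K (g y) py -> projects_to K (g z) pz ->
  a <= x -> x < y -> y < z -> z <= b ->
  enorm (g y - py) * (z - x) <= enorm (g x - px) * (z - y) + enorm (g z - pz) * (y - x).
Proof.
move=> cK gab cmp Px Py Pz ax xy yz zb.
have xz := lt_trans xy yz.
have L0 : 0 < z - x by rewrite subr_gt0.
pose l := (y - x) / (z - x).
have l0 : 0 <= l by rewrite divr_ge0 ?subr_ge0 ?ltW.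
have l1 : l <= 1 by rewrite ler_pdivrMr// mul1r lerD2r ltW.
have l1' : 0 <= 1 - l by rewrite subr_ge0.
have lE : y - x = l * (z - x) by rewrite divfK// gt_eqF.
have lE' : z - y = (1 - l) * (z - x) by rewrite mulrBl -lE; ring.
have Kp : K (px + l *: (pz - px)) by apply: cK; [exact: Px.1|exact: Pz.1|apply/andP].
have H := cmp _ Kp x y z ax xy yz zb.
have G := gab x z ax (ltW xz) zb.
have {}G : dotv (g z - g x) (g z - g x) <= (z - x) ^+ 2.
  by rewrite -sqr_enorm ler_sqr ?nnegrE ?enorm_ge0 ?(ltW L0).
rewrite lE lE' in H *; move: (z - x) L0 H G => L L0 H G.
rewrite [leRHS](_ : _ = ((1 - l) * enorm (g x - px) + l * enorm (g z - pz)) * L);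
  last by ring.
rewrite ler_pM2r//.
apply: le_trans (projects_to_le Py Kp) _.
apply: enorm_le.
  by apply: addr_ge0; apply: mulr_ge0 => //; exact: enorm_ge0.
have {}G := ler_wpM2l (mulr_ge0 l0 l1') G.
have xE : g x - (px + l *: (pz - px)) = (g x - px) - l *: (pz - px).
  by apply/rowP => j; rewrite !mxE; ring.
have zE : g z - (px + l *: (pz - px)) = (g z - pz) + (1 - l) *: (pz - px).
  by apply/rowP => j; rewrite !mxE; ring.
have xzE : g z - g x = (g z - pz) - (g x - px) + (pz - px).
  by apply/rowP => j; rewrite !mxE; ring.
rewrite xE zE in H; rewrite xzE in G.
move: (dotv (g y - _) _) H G => r.
have Huv := ler_wpM2l (mulr_ge0 l0 l1') (dotv_le (g x - px) (g z - pz)).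
have Hu := sqr_enorm (g x - px); have Hv := sqr_enorm (g z - pz).
move: (g x - px) (g z - pz) (pz - px) Huv Hu Hv => u v d.
rewrite !dotv_lin (dotvC v u) (dotvC d u) (dotvC d v) => Huv <- <-.
move: (enorm u) (enorm v) (dotv u v) (dotv u d) (dotv v d) (dotv d d) Huv.
move=> U V uv ud vd dd Huv H G.
have {}H : r + l * (1 - l) * L ^+ 2 <= (1 - l) * (U ^+ 2 - 2 * l * ud + l ^+ 2 * dd)
   + l * (V ^+ 2 + 2 * (1 - l) * vd + (1 - l) ^+ 2 * dd).
  by rewrite -(ler_pM2r L0); move: H; clear; lra.
by move: H G Huv; clear; lra.
Qed.

End Comparison.

(** * Trajectories receding from a convex set *)

Section Receding.
Context {R : realType} {m : nat}.
Implicit Types (g : R -> 'rV[R]_m) (K B : set 'rV[R]_m) (p q : 'rV[R]_m).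
Implicit Types (a b s t x y z : R).

(** The convex function [|g s - p|^2 - (s - a)^2] should have a nonnegative right derivative at [a].
    Derivatives are avoided by comparing with the time [a + h] for small [h]. *)
Lemma receding_dist a b g K p t :
  (forall p, K p -> comparison_on a b g p) -> projects_to K (g a) p ->
  (forall s, a < s -> s < t -> enorm (g a - p) <= enorm (g s - p)) ->
  a < t -> t <= b ->
  enorm (g a - p) ^+ 2 + (t - a) ^+ 2 <= dotv (g t - p) (g t - p).
Proof.
move=> cmp [Kp _] far at_ tb; apply/ler_addgt0Pr => e e0.
pose T := t - a; have T0 : 0 < T by rewrite subr_gt0.
(* The first bound keeps [a + h] before [t], the second makes the error [h * T] at most [e]. *)
pose h := Num.min (T / 2) (e / T).
have h0 : 0 < h by rewrite lt_min !divr_gt0.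
have hT : h < T by rewrite gt_min; apply/orP; left; lra.
have he : h * T <= e by rewrite -ler_pdivlMr// ge_min lexx orbT.
have sE : a + h < t by rewrite -ltrBrDl.
have := cmp p Kp a (a + h) t (lexx _) (ltr_pwDr h0 (lexx _)) sE tb.
have : enorm (g a - p) ^+ 2 <= dotv (g (a + h) - p) (g (a + h) - p).
  rewrite -sqr_enorm ler_sqr ?nnegrE ?enorm_ge0// far// ltr_pwDr//.
rewrite -/T -(sqr_enorm (g a - p)) (_ : t - (a + h) = T - h); last by rewrite /T; ring.
rewrite (_ : a + h - a = h); last by ring.
move: (dotv (g (a + h) - p) _) (dotv (g t - p) _) (enorm _) => r rt U.
move=> H1 H2.
have : (U ^+ 2 + (T - h) * T) * h <= rt * h.
  by have := ler_wpM2r (ltW T0) H1; move: H2; clear; lra.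
rewrite ler_pM2r// => H3; move: H3 he; clear; lra.
Qed.

(** Expand with [g t - p = (g t - q) + (q - p)]: the product of [g a - p] with the first summand is
    bounded by Cauchy-Schwarz, and with the second it is nonpositive because [p] is the foot of
    [g a]. *)
Lemma dist_foot_le K g a t p q : projects_to K (g a) p -> projects_to K (g t) q ->
  dotv (g t - p) (g t - p) <= enorm (g t - g a) ^+ 2 - enorm (g a - p) ^+ 2 +
     2 * enorm (g a - p) * enorm (g t - q).
Proof.
move=> [_ pvar] [Kq _]; have := pvar q Kq.
have := dotv_le (g a - p) (g t - q).
rewrite !sqr_enorm.
have -> : g t - g a = (g t - q) + (q - p) - (g a - p) by apply/rowP => j; rewrite !mxE; ring.
have -> : g t - p = (g t - q) + (q - p) by apply/rowP => j; rewrite !mxE; ring.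
move: (g a - p) (g t - q) (q - p) => u v d.
rewrite !dotv_lin (dotvC v u) (dotvC d u) (dotvC d v).
move: (enorm u) (enorm v) (dotv u v) (dotv u d) (dotv v d) => U V uv ud vd.
move: (dotv u u) (dotv v v) (dotv d d); clear; move => *; lra.
Qed.

(** With [T = t - a] and [G] the distance of [g a] and [g t], the two preceding bounds give
    [T^2 - G^2 <= 2 U V], where [U] and [V] are the distances to the feet; and
    [(T - G) T <= T^2 - G^2]. *)
Lemma excess_from_receding a b g K p q t :
  (forall p, K p -> comparison_on a b g p) -> nonexpanding_on a b g ->
  projects_to K (g a) p -> projects_to K (g t) q ->
  (forall s, a < s -> s < t -> enorm (g a - p) <= enorm (g s - p)) ->
  a < t -> t <= b ->
  excess g a t * (t - a) <= 2 * enorm (g a - p) * enorm (g t - q).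
Proof.
move=> cmp gab Pp Pq far at_ tb.
have := receding_dist cmp Pp far at_ tb; have := dist_foot_le Pp Pq.
have := excess_ge0 gab (lexx _) (ltW at_) tb; rewrite /excess.
have T0 : 0 < t - a by rewrite subr_gt0.
have := enorm_ge0 (g t - g a); have := sqr_ge0 (enorm (g a - p)).
move: (dotv _ _) (enorm (g a - p)) (enorm (g t - q)) (enorm (g t - g a)) => r U V G.
move: (t - a) T0; clear => T T0 U0 G0 E0 H1 H2.
have : 0 <= (T - G) * G by rewrite mulr_ge0.
move: U0 H1 H2; clear; lra.
Qed.

(** Put [T = s - a] and [L = t - s], and let [rs], [rt] be the distances of [g s], [g t] to [p].
    Comparison gives [L + T <= rt], so by the triangle inequality the excess is at most [rs - T];
    and [(rs - T) T] is at most half of [rs^2 - T^2], which [dist_foot_le] controls. *)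
Lemma excess_after_receding a b g K p q s t :
  (forall p, K p -> comparison_on a b g p) -> nonexpanding_on a b g ->
  projects_to K (g a) p -> projects_to K (g s) q ->
  (forall s', a < s' -> s' < s -> enorm (g a - p) <= enorm (g s' - p)) ->
  a < s -> s < t -> t <= b ->
  excess g s t * (s - a) <= enorm (g a - p) * enorm (g s - q).
Proof.
move=> cmp gab Pp Pq far as_ st tb.
have sb := ltW (lt_le_trans st tb).
have H1 := receding_dist cmp Pp far as_ sb; have H2 := dist_foot_le Pp Pq.
have H3 := cmp p Pp.1 a s t (lexx _) as_ st tb.
have GT := gab a s (lexx _) (ltW as_) sb.
have T0 : 0 < s - a by rewrite subr_gt0.
have L0 : 0 < t - s by rewrite subr_gt0.
have {}GT : enorm (g s - g a) ^+ 2 <= (s - a) ^+ 2.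
  by rewrite ler_sqr ?nnegrE ?enorm_ge0 ?(ltW T0).
have tri := enorm_triangle (g s) (g t) p.
rewrite -!sqr_enorm (_ : t - a = (t - s) + (s - a)) in H1 H2 H3; last by ring.
have U0 := enorm_ge0 (g a - p).
have r0 := enorm_ge0 (g s - p).
rewrite /excess; move: (enorm (g t - g s)) tri => G.
move: (enorm (g t - p)) (enorm (g s - p)) (enorm_ge0 (g t - p)) r0 H1 H2 H3.
move: (enorm (g a - p)) (enorm (g s - q)) (enorm (g s - g a)) U0 GT.
move: (s - a) (t - s) T0 L0; clear => T L T0 L0 U V G0 U0 GT rt rs rt0 rs0 H1 H2 H3 tri.
have T_rs : T <= rs.
  by rewrite -ler_sqr ?nnegrE ?(ltW T0)//; have := sqr_ge0 U; move: H1; clear; lra.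
have LT_rt : L + T <= rt.
  rewrite -ler_sqr ?nnegrE ?addr_ge0 ?(ltW T0) ?(ltW L0)// -(ler_pM2r T0).
  have : (U ^+ 2 + T ^+ 2) * (L + T) <= rs ^+ 2 * (L + T).
    by rewrite ler_wpM2r// addr_ge0 ?ltW.
  have := mulr_ge0 (sqr_ge0 U) (ltW T0).
  by move: H3; clear; lra.
have : (rs - T) * T <= (rs - T) * ((rs + T) / 2).
  by rewrite ler_wpM2l ?subr_ge0//; move: T_rs; clear; lra.
have : (L - G) * T <= (rs - T) * T.
  by rewrite ler_pM2r//; move: tri LT_rt; clear; lra.
have := sqr_ge0 U; move: H2 GT; clear; lra.
Qed.

(** Supplies the hypotheses of [bounded_growth]. A minimum of the distance to [K] at the first time
    also bounds the distance to the fixed foot [pr (t 0)] from below, which is the receding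
    condition. *)
Lemma few_blocks_receding g K (D : R) (t : nat -> R) (k : nat) (pr : R -> 'rV[R]_m) :
  0 < D -> (0 < k)%N -> (forall j, (j < k.+2)%N -> t j < t j.+1) ->
  segment_closed K -> nonexpanding_on (t 0%N) (t k.+2) g ->
  (forall p, K p -> comparison_on (t 0%N) (t k.+2) g p) ->
  (forall s, projects_to K (g s) (pr s)) ->
  0 < enorm (g (t 0%N) - pr (t 0%N)) ->
  (forall s, t 0%N <= s <= t k.+2 ->
    enorm (g (t 0%N) - pr (t 0%N)) <= enorm (g s - pr s)) ->
  (forall j, (j <= k)%N -> enorm (g (t j.+1) - pr (t j.+1)) ^+ 2 <=
    D * (t j.+1 - t j) * excess g (t j) (t j.+2)) ->
  k.-1%:R <= 4 * D ^+ 2 + 4 * D.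
Proof.
move=> D0 k0 tS cK gab cmp Ppr f0 fmin hits.
pose f j := enorm (g (t j) - pr (t j)).
have tle := increasing_prefix_le tS.
have t0 j : (j <= k.+2)%N -> t 0%N <= t j by move=> jk; apply: tle.
have t1 j : (j <= k.+2)%N -> t j <= t k.+2 by move=> jk; apply: tle; rewrite jk leqnn.
have tk : t 0%N < t k by rewrite (lt_le_trans (tS 0%N _))// tle// k0 leqW.
have tk1 : t k < t k.+1 by exact: tS.
have tk2 : t k.+1 < t k.+2 by exact: tS.
have far s s' : t 0%N < s' -> s' < s -> s <= t k.+2 ->
    enorm (g (t 0%N) - pr (t 0%N)) <= enorm (g s' - pr (t 0%N)).
  move=> s0 s's sk; apply: le_trans (fmin s' _) _; first by rewrite !ltW//; exact: lt_le_trans sk.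
  exact: projects_to_le (Ppr s') (Ppr (t 0%N)).1.
have ek : t k <= t k.+2 by apply: t1; rewrite leqW.
have fark s' : t 0%N < s' -> s' < t k ->
    enorm (g (t 0%N) - pr (t 0%N)) <= enorm (g s' - pr (t 0%N)).
  by move=> s0 s'k; apply: (far (t k)).
apply: (bounded_growth (t := t) (f := f) (E := fun i j => excess g (t i) (t j)) D0 k0 tS f0).
- by move=> j jk; apply: fmin; rewrite t0 ?t1// !leqW.
- exact: (excess_ge0 gab (lexx _) (ltW tk) ek).
- by apply: (excess_ge0 gab (ltW tk)) => //.
- exact: hits.
- move=> j jk; apply: (excess_le (a := t 0%N) (b := t k)).
  + exact: nonexpanding_onS gab.
  + by apply: t0; clear -jk; lia.
  + by apply: tle; clear -jk; lia.
  + by apply: tle; clear -jk; lia.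
- exact: (excess_from_receding cmp gab (Ppr _) (Ppr _) fark).
- apply: (excess_after_receding cmp gab (Ppr _) (Ppr _) fark) => //.
  exact: lt_trans tk2.
- have := distance_convex cK gab cmp (Ppr _) (Ppr _) (Ppr _) (lexx _) tk tk1 (ltW tk2).
  rewrite -/(f 0%N) -/(f k) -/(f k.+1) => H.
  by move: H; clear; lra.
Qed.

End Receding.

(** * Blocks of time in which every wall is visited *)

Section Blocks.
Context {R : realType} {m : nat}.
Implicit Types (g : R -> 'rV[R]_m) (K : set 'rV[R]_m) (p q : 'rV[R]_m).
Implicit Types (a b s t x y z : R).

Definition visits g K a b := exists2 s, a <= s <= b & K (g s).

Lemma nonexpanding_on_rev a b g : nonexpanding_on a b g ->
  nonexpanding_on (- b) (- a) (fun s => g (- s)).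
Proof.
move=> gab s t bs st ta; rewrite enormB.
rewrite (_ : t - s = - s - - t); last by ring.
by apply: gab; lra.
Qed.

Lemma comparison_on_rev a b g p : comparison_on a b g p ->
  comparison_on (- b) (- a) (fun s => g (- s)) p.
Proof.
move=> gab x y z bx xy yz za.
have := gab (- z) (- y) (- x); rewrite lerNr lerNl !ltrN2 => /(_ za yz xy bx).
move: (dotv _ _) (dotv _ _) (dotv _ _); clear => u v w; lra.
Qed.

Lemma visits_rev a b g K : visits g K a b -> visits (fun s => g (- s)) K (- b) (- a).
Proof. by move=> [s sab Ks]; exists (- s); rewrite ?opprK// !lerN2 andbC. Qed.

(** Each wall contains the chord between a visit before and a visit after [t], so [near_chord] and
    monotonicity of the excess bound the distance of [g t] to each wall; wide corners then bound the
    distance to the intersection. *)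
Lemma block_distance (I : Type) (F : set I) (B : I -> set 'rV[R]_m) theta g a t b p :
  (forall i, F i -> segment_closed (B i)) ->
  wide_corners theta (\bigcap_(i in F) B i) -> 0 < sin (theta / 2) ->
  nonexpanding_on a b g -> projects_to (\bigcap_(i in F) B i) (g t) p ->
  a <= t -> t <= b ->
  (forall i, F i -> visits g (B i) a t) -> (forall i, F i -> visits g (B i) t b) ->
  enorm (g t - p) ^+ 2 <= 2 / sin (theta / 2) ^+ 2 * (t - a) * excess g a b.
Proof.
move=> cB wB de0 gab Pp at_ tb va vb.
have e0 := excess_ge0 gab (lexx _) (le_trans at_ tb) (lexx _).
have Q0 : 0 <= 2 * (t - a) * excess g a b by rewrite !mulr_ge0// subr_ge0.
have near i : F i -> exists2 y, B i y & enorm (g t - y) <= Num.sqrt (2 * (t - a) * excess g a b).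
  move=> Fi; have [u /andP[au ut] Bu] := va i Fi; have [v /andP[tv vb'] Bv] := vb i Fi.
  move: (ut); rewrite le_eqVlt => /predU1P[<-|ut'].
    by exists (g u) => //; rewrite subrr enorm0 sqrtr_ge0.
  have uv : u < v := lt_le_trans ut' tv.
  have [y By Hy] := near_chord (nonexpanding_onS au vb' gab) ut tv uv (cB i Fi) Bu Bv.
  exists y => //; rewrite -(ger0_norm (enorm_ge0 _)) -sqrtr_sqr ler_sqrt//.
  apply: le_trans Hy _; apply: ler_pM.
  - by rewrite mulr_ge0// subr_ge0.
  - exact: (excess_ge0 gab au (ltW uv) vb').
  - by rewrite ler_pM2l// lerD2l lerN2.
  - exact: (excess_le gab au (ltW uv) vb').
have := wide_corner_error_bound cB wB Pp near (sqrtr_ge0 _).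
rewrite -ler_sqr ?nnegrE ?sqrtr_ge0 ?mulr_ge0 ?enorm_ge0 ?(ltW de0)// sqr_sqrtr// exprMn.
rewrite mulrC -ler_pdivlMr ?exprn_gt0// => H; apply: le_trans H _.
by rewrite le_eqVlt; apply/orP; left; apply/eqP; field; rewrite gt_eqF.
Qed.

Lemma few_blocks (I : Type) (F : set I) (B : I -> set 'rV[R]_m) theta g
    (t : nat -> R) (k : nat) :
  let K := \bigcap_(i in F) B i in let D := 2 / sin (theta / 2) ^+ 2 in
  let M := (k.+2 + k.+3)%N in
  (forall i, F i -> segment_closed (B i)) -> closed K -> K !=set0 ->
  wide_corners theta K -> 0 < sin (theta / 2) -> (0 < k)%N ->
  (forall j, (j < M)%N -> t j < t j.+1) ->
  nonexpanding_on (t 0%N) (t M) g ->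
  (forall p, K p -> comparison_on (t 0%N) (t M) g p) ->
  (forall j i, (j < M)%N -> F i -> visits g (B i) (t j) (t j.+1)) ->
  (forall j, (j <= M)%N -> ~ K (g (t j))) ->
  k.-1%:R <= 4 * D ^+ 2 + 4 * D.
Proof.
move=> K D M cB clK K0 wK de0 k0 tS gab cmp vis nK.
have cK : segment_closed K by exact: segment_closed_bigcap.
have D0 : 0 < D by rewrite divr_gt0// exprn_gt0.
have [pr Ppr] : {pr : 'rV[R]_m -> 'rV[R]_m & forall u, projects_to K u (pr u)}.
  by apply: choice => u; exact: projection_exists.
have tle := increasing_prefix_le tS.
have pos j : (j <= M)%N -> 0 < enorm (g (t j) - pr (g (t j))).
  move=> jM; rewrite lt_def enorm_ge0 andbT enorm_eq0; apply/eqP => /subr0_eq E.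
  by apply: (nK j jM); rewrite E; exact: (Ppr _).1.
have t23 : t k.+2 < t k.+3 by apply: tS; rewrite /M; clear; lia.
have e02 : t 0%N <= t k.+2 by apply: tle; rewrite /M; clear; lia.
have e3M : t k.+3 <= t M by apply: tle; rewrite /M; clear; lia.
(* The middle block decides the direction: by convexity the distance to [K] stays large after
   [t k.+3] or before [t k.+2]. On either side [k.+2] blocks are left, as [few_blocks_receding]
   requires; in the second case time is reversed. *)
have [le23|/ltW le32] := leP (enorm (g (t k.+2) - pr (g (t k.+2))))
                           (enorm (g (t k.+3) - pr (g (t k.+3)))).
- have Me : M = (k.+3 + k.+2)%N by rewrite /M addnC.
  apply: (@few_blocks_receding _ _ g K D (fun j => t (k.+3 + j)%N) k (pr \o g)) => //=;
    rewrite ?addn0 -?Me.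
  + by move=> j jk; rewrite addnS; apply: tS; rewrite /M; clear -jk; lia.
  + by apply: nonexpanding_onS gab; rewrite ?lexx// (le_trans e02)// ltW.
  + move=> p Kp; apply: comparison_onS (cmp p Kp); rewrite ?lexx// (le_trans e02)// ltW//.
  + by apply: pos; rewrite /M; clear; lia.
  + move=> s /andP[]; rewrite le_eqVlt => /predU1P[<-//|s3] sM.
    have L1 : 0 < s - t k.+3 by rewrite subr_gt0.
    have L2 : 0 < t k.+3 - t k.+2 by rewrite subr_gt0.
    rewrite -(ler_pM2r L2); have := ler_wpM2r (ltW L1) le23.
    have := distance_convex cK gab cmp (Ppr _) (Ppr _) (Ppr _) e02 t23 s3 sM.
    by clear; lra.
  + move=> j jk; have [jM1 jM2] : (k.+3 + j < M)%N /\ (k.+3 + j.+1 < M)%N.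
      by rewrite /M; clear -jk; split; lia.
    apply: (block_distance cB wK de0 _ (Ppr _)) => //; rewrite ?addnS.
    * apply: nonexpanding_onS gab; apply: tle; move: jM2; rewrite /M; clear; lia.
    * by rewrite ltW// tS.
    * by rewrite ltW// tS//; rewrite addnS in jM2.
    * by move=> i Fi; exact: vis.
    * by move=> i Fi; rewrite addnS in jM2; exact: vis.
- pose g' s := g (- s).
  apply: (@few_blocks_receding _ _ g' K D (fun j => - t (k.+2 - j)%N) k (pr \o g')) => //=;
    rewrite ?subn0 ?subnn.
  + by move=> j jk; rewrite ltrN2 -(subnSK jk); apply: tS; rewrite /M; clear; lia.
  + apply: nonexpanding_on_rev; apply: nonexpanding_onS gab; rewrite ?lexx//.
    by rewrite (le_trans _ e3M)// ltW.
  + move=> p Kp; apply: comparison_on_rev; apply: comparison_onS (cmp p Kp); rewrite ?lexx//.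
    by rewrite (le_trans _ e3M)// ltW.
  + by rewrite /g' opprK; apply: pos; rewrite /M; clear; lia.
  + move=> s /andP[]; rewrite lerNl lerNr /g' opprK => + s0.
    rewrite le_eqVlt => /predU1P[->//|s2].
    have L1 : 0 < t k.+2 - - s by rewrite subr_gt0.
    have L2 : 0 < t k.+3 - t k.+2 by rewrite subr_gt0.
    rewrite -(ler_pM2r L2); have := ler_wpM2r (ltW L1) le32.
    have := distance_convex cK gab cmp (Ppr _) (Ppr _) (Ppr _) s0 s2 t23 e3M.
    by clear; lra.
  + move=> j jk.
    (* Writing [k = n + j] removes the truncated subtractions from the reversed indices. *)
    have [n nE] : exists n, k = (n + j)%N by exists (k - j)%N; rewrite subnK.
    have -> : (k.+2 - j = n.+2)%N by rewrite nE; clear; lia.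
    have -> : (k.+2 - j.+1 = n.+1)%N by rewrite nE; clear; lia.
    have -> : (k.+2 - j.+2 = n)%N by rewrite nE; clear; lia.
    have [M0 M1] : (n < M)%N /\ (n.+1 < M)%N by rewrite /M nE; clear; split; lia.
    apply: (block_distance cB wK de0 _ (Ppr _)); rewrite ?lerN2.
    * apply: nonexpanding_on_rev; apply: nonexpanding_onS gab; apply: tle; move: M1; clear; lia.
    * by rewrite ltW// tS.
    * by rewrite ltW// tS.
    * by move=> i Fi; apply: visits_rev; exact: vis.
    * by move=> i Fi; apply: visits_rev; exact: vis.
Qed.

End Blocks.

(** * Smooth convex walls *)

Section RealInduction.
Context {R : realType}.

(** At the infimum of the times where [P] fails, [P] would hold by [left] (or [P a]), and [right]
    would push the failures away from it. *)
Lemma real_induction (P : R -> Prop) (a b : R) :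
  P a ->
  (forall t, a <= t < b -> P t -> \forall s \near t^'+, s <= b -> P s) ->
  (forall t, a < t <= b -> (forall s, a <= s < t -> P s) -> P t) ->
  forall t, a <= t <= b -> P t.
Proof.
move=> Pa right left t0 /andP[at0 t0b]; apply: contrapT => nPt0.
pose S := [set t | a <= t <= b /\ ~ P t].
have St0 : S t0 by split; rewrite ?at0.
have Slb : lbound S a by move=> x [/andP[]].
have Sinf : has_inf S by split; [exists t0|exists a].
pose t := inf S.
have at_ : a <= t by apply: lb_le_inf => //; exists t0.
have tb : t <= b by apply: le_trans t0b; apply: ge_inf => //; exists a.
have Pbefore s : a <= s < t -> P s.
  move=> /andP[as_ st]; apply: contrapT => nPs.
  have : t <= s by apply: ge_inf; [exists a|split=> //; rewrite as_ (le_trans (ltW st))].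
  by rewrite leNgt st.
have Pt : P t.
  move: at_; rewrite le_eqVlt => /predU1P[<-//|at_].
  by apply: left => //; rewrite at_.
have tb' : t < b.
  rewrite lt_neqAle tb andbT; apply/eqP => tE.
  by apply: nPt0; rewrite (_ : t0 = t)//; apply/le_anti; rewrite {1}tE t0b ge_inf//; exists a.
have [d /= d0 Hd] : \forall s \near t^'+, s <= b -> P s by apply: right; rewrite ?at_.
have [s [/andP[as_ sb] nPs] std] := inf_adherent d0 Sinf.
have ts : t <= s by apply: ge_inf; [exists a|split; rewrite ?as_].
move: ts; rewrite le_eqVlt => /predU1P[ts|ts]; first by apply: nPs; rewrite -ts.
apply: nPs; apply: (Hd s) => //; rewrite /ball_ /= distrC gtr0_norm ?subr_gt0//.
by rewrite ltrBlDl.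
Qed.

End RealInduction.

(** * First-order approximation from continuous partial derivatives *)

Section Differentiability.
Context {R : realType} {m : nat}.
Implicit Types (f : 'rV[R]_m -> R^o) (q h : 'rV[R]_m).

Lemma is_derive_along_axis f (x : 'rV[R]_m) (j : 'I_m) (s : R) :
  derivable f (x + s *: delta_mx 0 j) (delta_mx 0 j) ->
  is_derive s (1 : R) (fun r : R => f (x + r *: delta_mx 0 j) : R)
    (partial j f (x + s *: delta_mx 0 j)).
Proof.
have E : (fun t : R => t^-1 *: (f (x + (t *: (1 : R) + s) *: delta_mx 0 j) - f (x + s *: delta_mx 0 j))) =
   (fun t : R => t^-1 *: (f (t *: delta_mx 0 j + (x + s *: delta_mx 0 j)) - f (x + s *: delta_mx 0 j))).
  apply: funext => t; congr (_ *: (f _ - _)).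
  by rewrite scalerDl addrCA [t *: 1]mulr1.
move=> df; split; first by rewrite /derivable /= /comp /= E.
by rewrite /partial /derive /= /comp /= E.
Qed.

Lemma mean_value_deviation (psi dpsi : R -> R) (c d eta : R) :
  (forall s, `|s| <= `|c| -> is_derive s (1 : R) psi (dpsi s)) ->
  (forall s, `|s| <= `|c| -> `|dpsi s - d| <= eta) ->
  `|psi c - psi 0 - c * d| <= eta * `|c|.
Proof.
move=> dp bd.
have cont (a b : R) : (forall s, a <= s <= b -> `|s| <= `|c|) -> {within `[a, b], continuous psi}.
  move=> ab; apply: derivable_within_continuous => s; rewrite in_itv /= => sab.
  by have [] := dp s (ab s sab).
have [c0|c0] := leP 0 c.
  have cE s : 0 <= s <= c -> `|s| <= `|c| by move=> /andP[s0 sc]; rewrite !ger0_norm.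
  have [|s|x] := @MVT_segment R psi dpsi 0 c c0.
  - by move=> s; rewrite in_itv /= => /andP[s0 sc]; apply: dp; apply: cE; rewrite !ltW.
  - exact: cont cE s.
  rewrite in_itv /= => xc ->; rewrite subr0 (mulrC c) -mulrBl normrM.
  by rewrite ler_wpM2r// bd// cE.
have cE s : c <= s <= 0 -> `|s| <= `|c|.
  by move=> /andP[sc s0]; rewrite !ler0_norm ?lerN2// ltW.
have [|s|x] := @MVT_segment R psi dpsi c 0 (ltW c0).
- by move=> s; rewrite in_itv /= => /andP[s0 sc]; apply: dp; apply: cE; rewrite !ltW.
- exact: cont cE s.
rewrite in_itv /= => xc E.
have -> : psi c - psi 0 - c * d = (dpsi x - d) * c by move: E; clear; lra.
by rewrite normrM ler_wpM2r// bd// cE.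
Qed.

(** The class [class_C] only speaks of partial derivatives, so [h] is built up one coordinate at a
    time, and the mean value theorem bounds the error of each step. *)
Lemma first_order_approximation f q (U : set 'rV[R]_m) :
  open_nbhs q U -> class_C 1 U f -> forall eta : R, 0 < eta ->
  exists2 r : R, 0 < r & forall h, `|h| < r ->
    U (q + h) /\ `|f (q + h) - f q - dotv (grad f q) h| <= eta * `|h|.
Proof.
move=> qU [_ fU] eta eta0.
pose eta' := eta / (m%:R + 1).
have m1 : 0 < m%:R + 1 :> R by rewrite ltr_pwDr.
have eta'0 : 0 < eta' by rewrite divr_gt0.
have nU : nbhs q U by exact: open_nbhs_nbhs.
have Uq : U q := nbhs_singleton nU.
have F : ProperFilter (nbhs (q : 'rV[R]_m)) by exact: nbhs_pfilter.
have nb : \forall x \near q, U x /\ forall j, `|partial j f x - partial j f q| < eta'.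
  have H : forall j, \forall x \near q, `|partial j f x - partial j f q| < eta'; last first.
    by apply: filterI => //; exact: filter_forall H.
  move=> j.
  have [_ [/(_ q Uq) cj _]] := fU j.
  by move/cvgrPdist_lt : cj => /(_ _ eta'0); apply: filterS => x; rewrite distrC.
have /(@nbhs_ballP _ 'rV[R]_m)[r /= r0 Hr] := nb.
have {}Hr h : `|h| < r -> U (q + h) /\ forall j, `|partial j f (q + h) - partial j f q| < eta'.
  by move=> hr; apply: Hr; rewrite -ball_normE /ball_ /= opprD addNKr normrN.
exists r => // h hr; split; first by have [] := Hr h hr.
(* The first [k] coordinates of [h]; each of the [m] steps from [0] to [h] costs at most
   [eta' * |h|]. *)
pose hk k : 'rV[R]_m := \row_j (if (j < k)%N then h 0 j else 0).
have hk_norm (v : 'rV[R]_m) : (forall j, `|v 0 j| <= `|h 0 j|) -> `|v| < r.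
  move=> vh; apply: le_lt_trans hr; rewrite {1}/Num.Def.normr/= mx_normrE.
  apply: bigmax_le => [|[i j] _ /=]; first exact: normr_ge0.
  by rewrite (ord1 i); apply: le_trans (vh j) (norm_coord_le h j).
have step (k : nat) : (k <= m)%N ->
    `|f (q + hk k) - f q - dotv (grad f q) (hk k)| <= k%:R * (eta' * `|h|).
  elim: k => [_|k IH km].
    have -> : hk 0%N = 0 by apply/rowP => j; rewrite !mxE.
    by rewrite addr0 subrr sub0r dotvC -(scale0r (0 : 'rV[R]_m)) dotvZl !mul0r oppr0 normr0.
  pose j := Ordinal km.
  have hkS : hk k.+1 = hk k + h 0 j *: delta_mx 0 j.
    apply/rowP => i; rewrite !mxE eqxx ltnS leq_eqVlt.
    have [->|ij] := eqVneq i j; first by rewrite eqxx ltnn mulr1 add0r.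
    rewrite mulr0 addr0; case: eqP => // ik; case/eqP: ij; exact: val_inj.
  have inside s : `|s| <= `|h 0 j| -> `|(hk k + s *: delta_mx 0 j : 'rV[R]_m)| < r.
    move=> sh; apply: (hk_norm) => i; rewrite !mxE eqxx /=.
    have [->|ij] := eqVneq i j; first by rewrite ltnn mulr1 add0r.
    by rewrite mulr0 addr0; case: ifP; rewrite ?normr0.
  have M : `|f (q + hk k + h 0 j *: delta_mx 0 j) - f (q + hk k + 0 *: delta_mx 0 j) -
      h 0 j * partial j f q| <= eta' * `|h 0 j|.
    apply: (@mean_value_deviation (fun s => f (q + hk k + s *: delta_mx 0 j))
      (fun s => partial j f (q + hk k + s *: delta_mx 0 j))) => s sh.
      apply: is_derive_along_axis.
      by have [+ _] := fU j; apply; rewrite -addrA; have [] := Hr _ (inside s sh).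
    by rewrite -addrA; have [_ /(_ j)/ltW] := Hr _ (inside s sh).
  rewrite scale0r addr0 -(addrA q) -hkS in M.
  have {}IH := IH (ltnW km).
  have -> : dotv (grad f q) (hk k.+1) = dotv (grad f q) (hk k) + h 0 j * partial j f q.
    rewrite hkS dotvDr dotvZr; congr (_ + _ * _).
    rewrite dotvE (bigD1 j)//= big1 ?addr0 => [|i ij]; rewrite !mxE eqxx /=.
      by rewrite eqxx mulr1.
    by rewrite (negbTE ij) mulr0.
  have hj : eta' * `|h 0 j| <= eta' * `|h| by rewrite ler_pM2l// norm_coord_le.
  rewrite -natr1 mulrDl mul1r.
  apply: le_trans (lerD IH (le_trans M hj)).
  apply: le_trans (ler_normD _ _); rewrite le_eqVlt; apply/orP; left; apply/eqP.
  by congr `|_|; ring.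
have hm : hk m = h by apply/rowP => j; rewrite !mxE ltn_ord.
have := step m (leqnn m); rewrite hm => /le_trans; apply.
rewrite mulrA ler_wpM2r// /eta' mulrA ler_pdivrMr// mulrC ler_pM2l//.
by rewrite lerDl.
Qed.

End Differentiability.

(** * Outward normals and reflections of smooth convex walls *)

Section Walls.
Context {R : realType} {m : nat}.
Implicit Types (A B S : set 'rV[R]_m) (q x y z w u v nu : 'rV[R]_m).

Lemma line_nbhs x w (t : R) B : nbhs (x + t *: w) B ->
  exists2 d : R, 0 < d & forall s, `|s - t| < d -> B (x + s *: w).
Proof.
move=> /(@nbhs_ballP _ 'rV[R]_m)[e /= e0 eB].
have w1 : 0 < `|w| + 1 by rewrite ltr_wpDl.
exists (e / (`|w| + 1)) => [|s]; first exact: divr_gt0.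
rewrite ltr_pdivlMr// => st; apply: eB; rewrite -ball_normE /ball_ /=.
rewrite (_ : _ - _ = (t - s) *: w); last by rewrite scalerBl; apply/rowP => j; rewrite !mxE; ring.
rewrite normrZ distrC; apply: le_lt_trans st.
by rewrite ler_wpM2l// lerDl.
Qed.

Lemma not_boundary_interior A x : A x -> ~ boundary A x -> interior A x.
Proof.
by move=> Ax nb; apply: contrapT => nint; apply: nb; split => //; exact: subset_closure.
Qed.

(** Connectedness of the segment: off the boundary [A] is open, and it is closed anyway. *)
Lemma segment_avoiding_boundary A x w : closed A ->
  (forall t, 0 <= t <= 1 -> ~ boundary A (x + t *: w)) -> A x -> A (x + w).
Proof.
move=> clA nb Ax; rewrite -[w]scale1r.
apply: (@real_induction R (fun t => A (x + t *: w)) 0 1); last by rewrite ler01 lexx.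
- by rewrite scale0r addr0.
- move=> t /andP[t0 t1] At.
  have [|d d0 dA] := @line_nbhs x w t A.
    by apply: not_boundary_interior => //; apply: nb; rewrite t0 ltW.
  near=> s => _; apply: dA; rewrite gtr0_norm ?subr_gt0//.
  by rewrite ltrBlDl; near: s; apply: nbhs_right_lt; rewrite ltrDl.
- move=> t /andP[t0 t1] Abefore; apply: clA => B /line_nbhs[d d0 dB].
  pose s := Num.max 0 (t - d / 2).
  have s0 : 0 <= s by rewrite le_max lexx.
  have st : s < t by rewrite gt_max t0 /= ltrBlDr ltrDl divr_gt0.
  exists (x + s *: w); split; first by apply: Abefore; rewrite s0.
  apply: dB; rewrite ltr0_norm ?subr_lt0// opprB.
  have : t - d / 2 <= s by rewrite le_max lexx orbT.
  by move: d0; clear; lra.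
Unshelve. all: by end_near. Qed.

(** On all directions between [w1] and [w2] the linear part of [f], multiplied by [a], is at most
    [- c < 0], which the first-order error cannot compensate. *)
Lemma cone_avoids_level_set S q f (a : R) w1 w2 : local_equation S q f -> S q ->
  a * dotv (grad f q) w1 < 0 -> a * dotv (grad f q) w2 < 0 ->
  exists2 s0 : R, 0 < s0 & forall s t, 0 < s < s0 -> 0 <= t <= 1 ->
    ~ S (q + s *: (w1 + t *: (w2 - w1))).
Proof.
move=> [U [qU fU Sf _]] Sq a1 a2.
pose c := Num.min (- (a * dotv (grad f q) w1)) (- (a * dotv (grad f q) w2)).
have c0 : 0 < c by rewrite lt_min !oppr_gt0 a1.
have c1 : a * dotv (grad f q) w1 <= - c by rewrite lerNr ge_min lexx.
have c2 : a * dotv (grad f q) w2 <= - c by rewrite lerNr ge_min lexx orbT.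
pose W := `|w1| + `|w2 - w1|.
have W0 : 0 <= W by rewrite addr_ge0.
have W1 : 0 < W + 1 by rewrite ltr_wpDl.
have A1 : 0 < `|a| + 1 by rewrite ltr_wpDl.
(* Chosen so that [(|a| + 1) * (eta * (W + 1)) = c]; the added ones make the last estimates
   strict. *)
pose eta := c / ((`|a| + 1) * (W + 1)).
have eta0 : 0 < eta by rewrite divr_gt0 ?mulr_gt0.
have [r r0 Hr] := first_order_approximation qU (fU 1%N) eta0.
have Uq : U q by have [_] := qU.
exists (r / (W + 1)) => [|s t /andP[s0 sr] /andP[t0 t1] Ss]; first exact: divr_gt0.
set wt := w1 + t *: (w2 - w1) in Ss.
have wtW : `|wt| <= W.
  apply: le_trans (ler_normD _ _) _; rewrite lerD2l normrZ ger0_norm//.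
  by rewrite ler_piMl.
have [|Us] := Hr (s *: wt).
  rewrite normrZ gtr0_norm//; move: sr; rewrite ltr_pdivlMr//; apply: le_lt_trans.
  by rewrite ler_pM2l// (le_trans wtW)// lerDl.
rewrite (Sf _ Us).1// (Sf _ Uq).1// subrr sub0r normrN dotvZr => Hs.
have {Hs} : `|s * dotv (grad f q) wt : R| <= eta * `|s *: wt| := Hs.
rewrite normrM (normrZ s wt) gtr0_norm// mulrCA ler_pM2l// => H.
have wtc : a * dotv (grad f q) wt <= - c.
  rewrite /wt !dotv_lin; move: t0 t1 c1 c2; move: (dotv _ _) (dotv _ _) => e1 e2; clear; nra.
have B1 : c <= `|a| * `|dotv (grad f q) wt|.
  by rewrite -normrM -normrN; apply: le_trans (ler_norm _); rewrite lerNr.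
have B2 : `|a| * `|dotv (grad f q) wt| <= `|a| * (eta * `|wt|) by rewrite ler_wpM2l.
have B3 : `|a| * (eta * `|wt|) < (`|a| + 1) * (eta * (W + 1)).
  apply: (@le_lt_trans _ _ ((`|a| + 1) * (eta * `|wt|))).
    by rewrite ler_wpM2r ?lerDl// mulr_ge0// ltW.
  by rewrite ltr_pM2l// ltr_pM2l// (le_lt_trans wtW)// ltrDl.
have B4 : (`|a| + 1) * (eta * (W + 1)) = c.
  by rewrite /eta; field; rewrite !gt_eqF.
by have := le_lt_trans (le_trans B1 B2) B3; rewrite B4 ltxx.
Qed.

(** The homothety with centre [q + s (q - z)] and ratio [s / (1 + s)] takes a ball about [z] in [A]
    to a ball about [q], which convexity keeps in [A]. *)
Lemma interior_beyond A q z (s : R) : segment_closed A -> interior A z -> 0 < s ->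
  A (q + s *: (q - z)) -> interior A q.
Proof.
move=> cA /(@nbhs_ballP _ 'rV[R]_m)[e /= e0 eA] s0 Ay.
have s1 : 0 < 1 + s by rewrite addr_gt0.
have l0 : 0 < s / (1 + s) by rewrite divr_gt0.
apply/(@nbhs_ballP _ 'rV[R]_m); exists (e * (s / (1 + s))) => [|q'] /=; first exact: mulr_gt0.
rewrite -ball_normE /ball_ /= -ltr_pdivrMr// => qq'.
have Az' : A (z + (s / (1 + s))^-1 *: (q' - q)).
  apply: eA; rewrite -ball_normE /ball_ /=.
  rewrite (_ : _ - _ = (s / (1 + s))^-1 *: (q - q')); last first.
    by apply/rowP => j; rewrite !mxE; ring.
  by rewrite normrZ gtr0_norm ?invr_gt0// mulrC.
have := cA _ _ (s / (1 + s)) Ay Az'.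
rewrite (ltW l0) ler_pdivrMr// mul1r lerDr ler01 => /(_ isT).
by congr (A _); apply/rowP => j; rewrite !mxE; field; rewrite !lt0r_neq0.
Qed.

(** For small [s] the segment from [q + s w1], a point of [A], to [q + s w2] avoids the boundary, so
    its far end lies in [A] and off the boundary. *)
Lemma ray_enters_interior A q f (a : R) w1 w2 : closed A ->
  local_equation (boundary A) q f -> boundary A q ->
  a * dotv (grad f q) w1 < 0 -> a * dotv (grad f q) w2 < 0 ->
  (forall s, 0 <= s <= 1 -> A (q + s *: w1)) ->
  exists2 s0 : R, 0 < s0 & forall s, 0 < s < s0 -> interior A (q + s *: w2).
Proof.
move=> clA fq bq a1 a2 Aw1.
have [s0 s00 avoid] := cone_avoids_level_set fq bq a1 a2.
exists (Num.min s0 1) => [|s /andP[sp]]; first by rewrite lt_min s00/=.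
rewrite lt_min => /andP[ss0 s1].
have nb t : 0 <= t <= 1 -> ~ boundary A (q + s *: w1 + t *: (s *: (w2 - w1))).
  move=> t01; have := avoid s t; rewrite sp ss0 t01 => /(_ isT isT).
  by congr (~ boundary A _); apply/rowP => j; rewrite !mxE; ring.
have e1 : q + s *: w2 = q + s *: w1 + s *: (w2 - w1).
  by apply/rowP => j; rewrite !mxE; ring.
apply: not_boundary_interior; last first.
  by have := nb 1; rewrite ler01 lexx scale1r -e1; apply.
rewrite e1; apply: segment_avoiding_boundary => //.
by apply: Aw1; rewrite !ltW.
Qed.

(* The sign [a] makes [a * grad f q] point out of [A]. Directions in the same open
   half-space enter [A] together, since small segments between them avoid the
   boundary; if both half-spaces entered [A], then [q] would be interior. *)
Lemma smooth_wall_support A q f : closed A -> segment_closed A -> interior A !=set0 ->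
  boundary A q -> local_equation (boundary A) q f ->
  exists a : R, [/\ a * a = 1,
    forall z, A z -> a * dotv (grad f q) (z - q) <= 0 &
    forall w, a * dotv (grad f q) w < 0 ->
      exists2 s0 : R, 0 < s0 & forall s, 0 < s < s0 -> interior A (q + s *: w)].
Proof.
move=> clA cA [c Ac] bq fq.
have Aq : A q by apply: clA; have [] := bq.
have nAq : ~ interior A q by have [] := bq.
have ray z s : A z -> 0 <= s <= 1 -> A (q + s *: (z - q)) by move=> Az s01; exact: cA.
have same_side a z1 z2 : interior A z1 -> A z2 ->
    a * dotv (grad f q) (z1 - q) < 0 -> ~ 0 < a * dotv (grad f q) (z2 - q).
  move=> Az1 Az2 n1 p2; apply: nAq.
  (* Since [z2] and [q - z1] point to the same side, the ray from [q] away from [z1] enters [A];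
     then [q] lies strictly between the interior point [z1] and a point of [A]. *)
  have [||s|s0 s00 H] := @ray_enters_interior A q f (- a) (z2 - q) (q - z1) clA fq bq.
  - by rewrite mulNr oppr_lt0.
  - by rewrite -(opprB z1) dotvNr mulrNN.
  - exact: ray.
  have h : 0 < s0 / 2 < s0 by apply/andP; split; lra.
  apply: (@interior_beyond A q z1 (s0 / 2)) => //; first by case/andP: h.
  exact: interior_subset (H _ h).
have g0 : grad f q != 0 by have [U []] := fq.
have gg : 0 < dotv (grad f q) (grad f q) by rewrite lt_def dotvv_ge0 dotvv_eq0 g0.
(* Otherwise small shifts of [c] along plus and minus the gradient would be interior points on both
   sides of the tangent hyperplane. *)
have Dc0 : dotv (grad f q) (c - q) != 0.
  apply/eqP => Dc0.
  have [|d d0 dA] := @line_nbhs c (grad f q) 0 (interior A).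
    by rewrite scale0r addr0; apply: open_nbhs_nbhs; split => //; exact: open_interior.
  have h : 0 < d / 2 < d by apply/andP; split; lra.
  have h1 : `|- (d / 2) - 0| < d by rewrite subr0 normrN gtr0_norm; case/andP: h.
  have h2 : `|d / 2 - 0| < d by rewrite subr0 gtr0_norm; case/andP: h.
  have e (s : R) : c + s *: grad f q - q = (c - q) + s *: grad f q.
    by apply/rowP => j; rewrite !mxE; ring.
  apply: (same_side 1 _ _ (dA _ h1) (interior_subset (dA _ h2))).
    by rewrite mul1r e dotvDr Dc0 add0r dotvZr mulNr oppr_lt0 mulr_gt0// divr_gt0.
  by rewrite mul1r e dotvDr Dc0 add0r dotvZr mulr_gt0// divr_gt0.
have [a [aa Da]] : exists a : R, a * a = 1 /\ a * dotv (grad f q) (c - q) < 0.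
  have [D|D|D] := ltgtP (dotv (grad f q) (c - q)) 0.
  - by exists 1; rewrite !mul1r.
  - by exists (-1); rewrite mulrNN mulN1r mulr1 oppr_lt0.
  - by rewrite D eqxx in Dc0.
exists a; split => // [z Az|w wa].
  by rewrite leNgt; apply/negP; exact: same_side Da.
apply: (@ray_enters_interior A q f a (c - q) w clA fq bq Da wa) => s.
exact: ray (interior_subset Ac).
Qed.

(** Here [nu] is the unit normal pointing out of [A]. If [dotv u nu] were positive, [- u] would
    point into [A] and [q - s *: u] would be interior for small [s]; reflection flips the sign. *)
Lemma reflection_normal A q u v : convex_wall A ->
  (exists2 d : R, 0 < d & forall s, 0 < s < d -> ~ interior A (q - s *: u)) ->
  reflects (boundary A) q u v ->
  exists nu, [/\ v = u + (2 * dotv v nu) *: nu, 0 <= dotv v nu &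
    forall z, A z -> dotv (z - q) nu <= 0].
Proof.
move=> [clA /convex_set_segment cA iA smA] [d d0 out] [bq refl].
have [f fq] := smA q bq.
have [a [aa supp enters]] := smooth_wall_support clA cA iA bq fq.
have g0 : grad f q != 0 by have [U []] := fq.
pose G := enorm (grad f q).
have G0 : 0 < G by rewrite lt_def enorm_ge0 enorm_eq0 g0.
pose nu := (a / G) *: grad f q.
have nunu : dotv nu nu = 1.
  rewrite /nu dotvZl dotvZr -sqr_enorm -/G.
  transitivity (a * a); last exact: aa.
  by field; exact: lt0r_neq0.
have normal : unit_normal (boundary A) q nu.
  split; first by rewrite /enorm nunu sqrtr1.
  exists f => //; exists (a * G); rewrite /nu scalerA.
  rewrite (_ : a * G * (a / G) = 1) ?scale1r//.
  by transitivity (a * a); [field; exact: lt0r_neq0|exact: aa].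
have E := refl nu normal.
have vnu : dotv v nu = - dotv u nu.
  rewrite E dotvDl dotvNl dotvZl nunu; ring.
exists nu; split.
- by rewrite vnu {1}E mulrN scaleNr.
- rewrite vnu oppr_ge0 leNgt; apply/negP => unu.
  have [|s0 s00 H] := enters (- u).
    rewrite dotvNr mulrN oppr_lt0; move: unu.
    rewrite /nu dotvZr (dotvC u) => /(mulr_gt0 G0).
    by rewrite mulrA (_ : G * (a / G) = a)//; field; exact: lt0r_neq0.
  pose s := Num.min d s0 / 2.
  have mn : 0 < Num.min d s0 by rewrite lt_min d0.
  have sp : 0 < s by rewrite divr_gt0.
  have sm : s < Num.min d s0 by rewrite /s; lra.
  move: sm; rewrite lt_min => /andP[sd ss0].
  apply: (out s); first by rewrite sp.
  by rewrite -scalerN; apply: H; rewrite sp.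
- move=> z Az; rewrite /nu dotvZr (dotvC (z - q)) mulrAC.
  by rewrite pmulr_lle0 ?invr_gt0// supp.
Qed.

End Walls.
(** * Trajectories *)

Section Trajectories.
Context {R : realType}.

(* [M] is the right derivative of [psi]. *)
Lemma piecewise_affine_convex (psi M : R -> R) (a b : R) :
  (forall t, a <= t < b -> \forall s \near t^'+, s <= b ->
     psi s = psi t + M t * (s - t) /\ M s = M t) ->
  (forall t, a < t <= b -> \forall s \near t^'-, a <= s ->
     psi t = psi s + M s * (t - s) /\ (t < b -> M s <= M t)) ->
  forall x y z, a <= x -> x < y -> y < z -> z <= b ->
    (psi y - psi x) * (z - y) <= (psi z - psi y) * (y - x).
Proof.
move=> right left x y z ax xy yz zb.
have yb := lt_le_trans yz zb; have ay := le_trans ax (ltW xy).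
have pick c t : a <= c -> c < t -> t <= b -> exists s, [/\ c <= s < t,
    psi t = psi s + M s * (t - s) & t < b -> M s <= M t].
  move=> ac ct tb; have at_ := le_lt_trans ac ct.
  have L := left t; rewrite at_ tb in L; have {}L := L isT.
  have nc : \forall s \near t^'-, c < s by exact: nbhs_left_gt.
  have nt : \forall s \near t^'-, s < t by exact: nbhs_left_lt.
  have [s [[cs st] H]] := filter_ex (filterI (filterI nc nt) L).
  have [|H1 H2] := H; first by rewrite (le_trans ac)// ltW.
  by exists s; rewrite (ltW cs) st.
(* Both chords at [y] are compared with the slope [M y]. The guards [t < b] occur because a right
   derivative says nothing at [b]. *)
have upper : psi y - psi x <= M y * (y - x).
  suff : y < b -> psi y - psi x <= M y * (y - x) by apply.
  apply: (@real_induction R (fun t => t < b -> psi t - psi x <= M t * (t - x)) x b).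
  - by move=> _; rewrite !subrr mulr0.
  - move=> t /andP[xt tb] H; have := right t; rewrite (le_trans ax xt) tb => /(_ isT).
    apply: filterS => s Hs sb _; have [-> ->] := Hs sb.
    by have := H tb; clear; lra.
  - move=> t /andP[xt tb] H tb'; have [s [xs -> Ms]] := pick x t ax xt tb.
    have [xs1 xs2] := andP xs; have := H s xs (lt_le_trans xs2 tb).
    have := Ms tb'; rewrite -(ler_pM2r (_ : 0 < t - x)) ?subr_gt0//; clear; lra.
  - by rewrite ltW// ltW.
(* The monotonicity of [M] from [y] on is carried through the induction together with the bound. *)
have lower : psi y + M y * (z - y) <= psi z.
  suff [] : psi y + M y * (z - y) <= psi z /\ (z < b -> M y <= M z) by [].
  apply: (@real_induction R (fun t => psi y + M y * (t - y) <= psi t /\ (t < b -> M y <= M t)) y b).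
  - by rewrite subrr mulr0 addr0.
  - move=> t /andP[yt tb] [H1 /(_ tb) H2]; have := right t; rewrite (le_trans ay yt) tb => /(_ isT).
    have nt : \forall s \near t^'+, t < s by exact: nbhs_right_gt.
    apply: filterS2 nt => s ts Hs sb; have [-> ->] := Hs sb; split=> //.
    move: H2; rewrite -(ler_pM2r (_ : 0 < s - t)) ?subr_gt0//; move: H1; clear; lra.
  - move=> t /andP[yt tb] H; have [s [ys E Ms]] := pick y t ay yt tb.
    have [ys1 ys2] := andP ys; have [H1 /(_ (lt_le_trans ys2 tb)) H2] := H s ys.
    split=> [|tb']; last exact: le_trans H2 (Ms tb').
    rewrite E; move: H2; rewrite -(ler_pM2r (_ : 0 < t - s)) ?subr_gt0//; move: H1; clear; lra.
  - by rewrite (ltW yz).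
apply: (@le_trans _ _ (M y * (y - x) * (z - y))).
  by rewrite ler_pM2r// subr_gt0.
rewrite mulrAC ler_pM2r ?subr_gt0//; move: lower; clear; lra.
Qed.

Context {m n : nat} (A : 'I_n -> set 'rV[R]_m) (J : set R) (g : R -> 'rV[R]_m).
Implicit Types (u v p : 'rV[R]_m) (s t a b : R).

Lemma velocity_after_unique t u v :
  velocity_after J g t u -> velocity_after J g t v -> u = v.
Proof.
move=> tu tv; near t^'+ => s.
have ts : t < s by near: s; exact: nbhs_right_gt.
have [_ su] : J s /\ g s = g t + (s - t) *: u by near: s.
have [_ sv] : J s /\ g s = g t + (s - t) *: v by near: s.
have st0 : s - t != 0 by rewrite gt_eqF// subr_gt0.
by apply: (scalerI st0); apply: (addrI (g t)); rewrite -su -sv.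
Unshelve. all: by end_near. Qed.

Lemma velocity_after_step t v : velocity_after J g t v ->
  \forall s \near t^'+, velocity_after J g s v /\ g s = g t + (s - t) *: v.
Proof.
move=> [d /= d0 Hd].
have H s : t < s < t + d -> J s /\ g s = g t + (s - t) *: v.
  move=> /andP[ts sd]; apply: Hd => //=.
  by rewrite distrC gtr0_norm ?subr_gt0// ltrBlDl.
near=> s.
have ts : t < s by near: s; exact: nbhs_right_gt.
have sd : s < t + d by near: s; apply: nbhs_right_lt; rewrite ltrDl.
have [Js gs] := H s (introT andP (conj ts sd)).
split=> //; near=> r.
have sr : s < r by near: r; exact: nbhs_right_gt.
have rd : r < t + d by near: r; exact: nbhs_right_lt.
have [Jr gr] := H r (introT andP (conj (lt_trans ts sr) rd)).
split=> //; rewrite gr gs; apply/rowP => j; rewrite !mxE; ring.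
Unshelve. all: by end_near. Qed.

Lemma velocity_before_step t u : velocity_before J g t u ->
  \forall s \near t^'-, velocity_after J g s u /\ g t = g s + (t - s) *: u.
Proof.
move=> [d /= d0 Hd].
have H s : t - d < s < t -> J s /\ g s = g t + (s - t) *: u.
  move=> /andP[ds st]; apply: Hd => //=.
  by rewrite gtr0_norm ?subr_gt0// ltrBlDr -ltrBlDl.
near=> s.
have st : s < t by near: s; exact: nbhs_left_lt.
have sd : t - d < s by near: s; apply: nbhs_left_gt; rewrite ltrBlDr ltrDl.
have [Js gs] := H s (introT andP (conj sd st)).
split; last by rewrite gs; apply/rowP => j; rewrite !mxE; ring.
near=> r.
have sr : s < r by near: r; exact: nbhs_right_gt.
have rt : r < t by near: r; exact: nbhs_right_lt.
have [Jr gr] := H r (introT andP (conj (lt_trans sd sr) rt)).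
split=> //; rewrite gr gs; apply/rowP => j; rewrite !mxE; ring.
Unshelve. all: by end_near. Qed.

Lemma table_not_interior i x : table A x -> ~ interior (A i) x.
Proof. by move=> Tx /Tx[y [ny Ay]]; apply: ny; exists i. Qed.

Hypothesis Awall : forall i, convex_wall (A i).
Hypothesis traj : billiard_trajectory A J g.

Lemma collision_normal i t u v : break_point J g t u v ->
  reflects (boundary (A i)) (g t) u v ->
  exists nu, [/\ v = u + (2 * dotv v nu) *: nu, 0 <= dotv v nu &
    forall z, A i z -> dotv (z - g t) nu <= 0].
Proof.
move=> [Jt [d /= d0 Hd] _ _]; apply: reflection_normal => //.
exists d => // s /andP[s0 sd].
have [||Js] := Hd (t - s).
- by rewrite /= opprB addrC subrK gtr0_norm.
- by rewrite ltrBlDr ltrDl.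
rewrite addrAC subrr add0r scaleNr => <-.
exact: table_not_interior (trajectory_in_table traj Js).
Qed.

Definition collides_only (F : set 'I_n) a b := forall t u v, a <= t <= b ->
  break_point J g t u v -> exists2 i, F i & reflects (boundary (A i)) (g t) u v.

Lemma domain_segment a b t : J a -> J b -> a <= t <= b -> J t.
Proof. by move=> Ja Jb; exact: (trajectory_interval traj). Qed.

Lemma nonexpanding_trajectory a b : J a -> J b -> nonexpanding_on a b g.
Proof.
move=> Ja Jb s t as_ st tb.
have sb := le_trans st tb.
have Jseg r : s <= r <= b -> J r.
  by move=> /andP[sr rb]; apply: (domain_segment Ja Jb); rewrite (le_trans as_).
apply: (@real_induction R (fun t => enorm (g t - g s) <= t - s) s b).
- by rewrite !subrr enorm0.
- move=> r /andP[sr rb] H.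
  have Jr : J r by apply: Jseg; rewrite sr ltW.
  have [_ []] := trajectory_polygonal traj Jr; first by exists b.
  move=> v v1 av; near=> q => _.
  have rq : r < q by near: q; exact: nbhs_right_gt.
  have [_ ->] : J q /\ g q = g r + (q - r) *: v by near: q.
  apply: le_trans (enorm_triangle (g r) _ _) _.
  rewrite addrAC subrr add0r enormZ v1 mulr1 gtr0_norm ?subr_gt0//.
  by rewrite -[leRHS](subrKA r) lerD2l.
- move=> r /andP[sr rb] H.
  have Jr : J r by apply: Jseg; rewrite rb ltW.
  have ex : exists2 q, J q & q < r by exists s => //; apply: Jseg; rewrite lexx.
  have [/(_ ex)[u u1 bu] _] := trajectory_polygonal traj Jr.
  near r^'- => q.
  have sq : s < q by near: q; exact: nbhs_left_gt.
  have qr : q < r by near: q; exact: nbhs_left_lt.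
  have [_ gq] : velocity_after J g q u /\ g r = g q + (r - q) *: u.
    by near: q; exact: velocity_before_step.
  have := H q; rewrite (ltW sq) qr => /(_ isT) {}H.
  rewrite gq; apply: le_trans (enorm_triangle (g q) _ _) _.
  rewrite addrAC subrr add0r enormZ u1 mulr1 gtr0_norm ?subr_gt0//.
  by rewrite -[leRHS](subrKA q) lerD2l.
- by rewrite st.
Unshelve. all: by end_near. Qed.

(** The function [|g t - p|^2 - t^2] is affine between collisions, so only the jumps of its slope at
    collisions matter. *)
Lemma comparison_trajectory (F : set 'I_n) a b p : J a -> J b ->
  collides_only F a b -> (\bigcap_(i in F) A i) p -> comparison_on a b g p.
Proof.
move=> Ja Jb onlyF Fp.
have Jseg := domain_segment Ja Jb.
have [V HV] : {V : R -> 'rV[R]_m & forall t, a <= t < b ->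
    enorm (V t) = 1 /\ velocity_after J g t (V t)}.
  apply: (@choice R 'rV[R]_m (fun t v => a <= t < b -> enorm v = 1 /\ velocity_after J g t v)) => t.
  have [tab|ntab] := pselect (a <= t < b); last by exists 0.
  have [at_ tb] := andP tab.
  have Jt : J t by apply: Jseg; rewrite at_ ltW.
  have [_ [|v v1 av]] := trajectory_polygonal traj Jt; first by exists b.
  by exists v.
pose psi t := dotv (g t - p) (g t - p) - t ^+ 2.
pose M t := 2 * (dotv (V t) (g t - p) - t).
have conv := @piecewise_affine_convex psi M a b.
suff H : forall x y z, a <= x -> x < y -> y < z -> z <= b ->
    (psi y - psi x) * (z - y) <= (psi z - psi y) * (y - x).
  move=> x y z ax xy yz zb; have := H x y z ax xy yz zb; rewrite /psi.
  move: (dotv _ _) (dotv _ _) (dotv _ _); clear => r1 r2 r3; lra.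
have psi_step s t v : enorm v = 1 -> g t = g s + (t - s) *: v ->
    psi t = psi s + 2 * (dotv v (g s - p) - s) * (t - s).
  move=> v1 gt_; rewrite /psi gt_.
  have -> : g s + (t - s) *: v - p = (g s - p) + (t - s) *: v.
    by apply/rowP => j; rewrite !mxE; ring.
  rewrite !dotv_lin (dotvC v (g s)) (dotvC v p) (dotvC p (g s)) -(sqr_enorm v) v1; ring.
have M_step s t v : enorm v = 1 -> g t = g s + (t - s) *: v ->
    2 * (dotv v (g t - p) - t) = 2 * (dotv v (g s - p) - s).
  move=> v1 ->; have -> : g s + (t - s) *: v - p = (g s - p) + (t - s) *: v.
    by apply/rowP => j; rewrite !mxE; ring.
  by rewrite dotvDr dotvZr -(sqr_enorm v) v1; ring.
apply: conv => [t /andP[at_ tb]|t /andP[at_ tb]].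
- have [|Vt1 Vt] := HV t; first by rewrite at_.
  near=> s => _.
  have ts : t < s by near: s; exact: nbhs_right_gt.
  have sb : s < b by near: s; exact: nbhs_right_lt.
  have [Vs gs] : velocity_after J g s (V t) /\ g s = g t + (s - t) *: V t.
    by near: s; exact: velocity_after_step.
  split; first exact: psi_step.
  have [|_ Vs'] := HV s; first by rewrite sb (le_trans at_)// ltW.
  by rewrite /M (velocity_after_unique Vs' Vs); exact: M_step.
- have Jt : J t by apply: Jseg; rewrite ltW.
  have ex : exists2 q, J q & q < t by exists a.
  have [/(_ ex)[u u1 bu] _] := trajectory_polygonal traj Jt.
  near=> s => as_.
  have st : s < t by near: s; exact: nbhs_left_lt.
  have [Vs gt_] : velocity_after J g s u /\ g t = g s + (t - s) *: u.
    by near: s; exact: velocity_before_step.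
  have [|_ Vs'] := HV s; first by rewrite as_ (lt_le_trans st).
  have VsE : V s = u := velocity_after_unique Vs' Vs.
  split; first by rewrite /M VsE; exact: psi_step.
  move=> tb'; have [|_ Vt] := HV t; first by rewrite (ltW at_).
  rewrite /M VsE -(M_step _ _ _ u1 gt_) ler_pM2l// lerD2r.
  have [<-//|uV] := eqVneq u (V t).
  have bp : break_point J g t u (V t) by [].
  have [|i Fi ri] := onlyF _ _ _ _ bp; first by rewrite tb (ltW at_).
  (* The jump of [M] is [4 (v . nu) (nu . (g t - p))]; both factors are nonnegative because [p] lies
     in the wall that is hit. *)
  have [nu [E vnu sup]] := collision_normal bp ri.
  rewrite [in leRHS]E dotvDl dotvZl lerDl mulr_ge0 ?mulr_ge0//.
  by have := sup p (Fp i Fi); rewrite -(opprB (g t)) dotvNl oppr_le0 dotvC.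
Unshelve. all: by end_near. Qed.

End Trajectories.

(** * Counting collisions *)

Section Counting.
Context {R : realType}.

Lemma increasing_enumeration (S : set R) (N : nat) : ~ (S #<= `I_N)%card ->
  exists c : nat -> R, (forall j, (j < N)%N -> c j < c j.+1) /\
    (forall j, (j <= N)%N -> S (c j)).
Proof.
move=> SN.
have [r [ru rS rN]] : exists r : seq R,
    [/\ uniq r, forall x, x \in r -> S x & (N < size r)%N].
  have [finS|infS] := pselect (finite_set S).
    exists (finmap.enum_fset (fset_set S)); split; first exact: finmap.fset_uniq.
    - by move=> x; rewrite in_fset_set// inE.
    - rewrite ltnNge; apply/negP => sN; apply: SN.
      have E := fset_setK finS.
      have /card_eq_fsetP := erefl (size (finmap.enum_fset (fset_set S))).
      rewrite E => /card_eqPle[+ _] => /card_le_trans; apply.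
      by rewrite card_le_II.
  have [B BS NB] := infinite_set_fset N.+1 infS.
  exists (finmap.enum_fset B); split=> //; first exact: finmap.fset_uniq.
pose s := sort <=%R r.
have sz : (N < size s)%N by rewrite size_sort.
exists (fun j => nth 0 s j); split=> j jN.
- have ss : sorted <%R s by rewrite sort_lt_sorted.
  by apply: (sorted_ltn_nth lt_trans 0 ss) => //; rewrite inE; apply: leq_trans sz; rewrite ltnS // ltnW.
- by apply: rS; rewrite -(mem_sort <=%R) mem_nth//; exact: leq_ltn_trans sz.
Qed.

Definition nondegenerate_walls (n m : nat) (eps : R) (A : 'I_n -> set 'rV[R]_m) :=
  [/\ forall i, convex_wall (A i), exists p, forall i, interior (A i) p &
   forall F : set 'I_n, F !=set0 -> wide_corners eps (\bigcap_(i in F) A i)].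

(** A cone of aperture [eps] exists at a point of the first wall, which forces [0 < eps < pi]. *)
Lemma wide_corner_angle (n m : nat) eps (A : 'I_n -> set 'rV[R]_m) :
  (0 < n)%N -> nondegenerate_walls eps A -> 0 < sin (eps / 2).
Proof.
case: n A => // n A _ [_ [p Ap] wide].
have [||C /cone_contains_ball[]//] := wide [set ord0] _ p; first by exists ord0.
by move=> i ->; exact: interior_subset.
Qed.

(* [c 0, ..., c M] are [M + 1] collision times, so [N] bounds their number. *)
Definition collision_bound (n : nat) (eps : R) (k N : nat) :=
  forall (m : nat) (A : 'I_n -> set 'rV[R]_m) (J : set R) (g : R -> 'rV[R]_m)
    (S : {set 'I_n}) (c : nat -> R) (M : nat),
  nondegenerate_walls eps A -> billiard_trajectory A J g -> (#|S| <= k)%N ->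
  (forall j, (j < M)%N -> c j < c j.+1) ->
  (forall j, (j <= M)%N -> collisions J g (c j)) ->
  collides_only A J g [set i | i \in S] (c 0%N) (c M) -> (M < N)%N.

Lemma collides_onlyS (n m : nat) (A : 'I_n -> set 'rV[R]_m) J g F a b a' b' :
  a <= a' -> b' <= b -> collides_only A J g F a b -> collides_only A J g F a' b'.
Proof.
move=> aa bb H t u v /andP[a't tb']; apply: H.
by rewrite (le_trans aa)// (le_trans tb').
Qed.

Lemma collision_bound0 (n : nat) (eps : R) : collision_bound n eps 0 0.
Proof.
move=> m A J g S c M _ _ S0 cS col only.
have [u [v bp]] := col 0%N (leq0n M).
have [|i] := only (c 0%N) u v _ bp.
  by rewrite lexx; apply: (increasing_prefix_le cS); rewrite leqnn.
by move: S0; rewrite leqn0 cards_eq0 => /eqP ->; rewrite /= inE.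
Qed.

(** The distance to [A i] is convex on [[a, b]] and vanishes at both ends, so the trajectory would
    stay in [A i]; but right after the collision at [a] it moves strictly to the outer side of a
    supporting hyperplane. *)
Lemma single_wall (n m : nat) eps (A : 'I_n -> set 'rV[R]_m) J g i a b :
  nondegenerate_walls eps A -> billiard_trajectory A J g ->
  a < b -> collisions J g a -> J b -> A i (g b) -> collides_only A J g [set i] a b -> False.
Proof.
move=> [walls _ _] traj ab [u [v bp]] Jb Ab only.
have [Ja _ av uv] := bp.
have [|_ -> ri] := only a u v _ bp; first by rewrite lexx ltW.
have [nu [E vnu sup]] := collision_normal walls traj bp ri.
have Aa : A i (g a) by have [clA _ _ _] := walls i; apply: clA; have [[]] := ri.
have vnu0 : 0 < dotv v nu.
  rewrite lt_def vnu andbT; apply: contra uv => /eqP vnu0.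
  by rewrite E vnu0 mulr0 scale0r addr0.
have cA : segment_closed (A i) by have [_ /convex_set_segment] := walls i.
near a^'+ => s.
have as_ : a < s by near: s; exact: nbhs_right_gt.
have sb : s < b by near: s; exact: nbhs_right_lt.
have [Js gs] : J s /\ g s = g a + (s - a) *: v by near: s.
have clA : closed (A i) by have [] := walls i.
have nonexp := nonexpanding_trajectory traj Ja Jb.
have cmp p : A i p -> comparison_on a b g p.
  move=> Ap; apply: (comparison_trajectory walls traj Ja Jb only).
  by move=> _ ->.
have [p Pp] : exists p, projects_to (A i) (g s) p.
  by apply: projection_exists => //; exists (g a).
have self t : A i (g t) -> projects_to (A i) (g t) (g t).
  by move=> At; split=> // z _; rewrite subrr -(scale0r (0 : 'rV[R]_m)) dotvZl mul0r.
have := distance_convex cA nonexp cmp (self _ Aa) Pp (self _ Ab) (lexx _) as_ sb (lexx _).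
rewrite !subrr enorm0 !mul0r addr0 pmulr_lle0 ?subr_gt0// => H.
have /eqP : enorm (g s - p) = 0 by apply/le_anti; rewrite H enorm_ge0.
rewrite enorm_eq0 subr_eq0 => /eqP gsp.
have := sup (g s); rewrite {1}gsp => /(_ Pp.1).
rewrite gs addrAC subrr add0r dotvZl leNgt mulr_gt0// subr_gt0//.
Unshelve. all: by end_near. Qed.

Lemma collision_bound1 (n : nat) (eps : R) : collision_bound n eps 1 1.
Proof.
move=> m A J g S c M nd traj S1 cS col only; rewrite ltnS leqNgt; apply/negP => M0.
have cle := increasing_prefix_le cS.
have hit j : (j <= M)%N -> exists2 i, i \in S & A i (g (c j)).
  move=> jM; have [u [v bp]] := col j jM.
  have [|i iS [bi _]] := only (c j) u v _ bp; first by rewrite !cle ?leqnn ?jM.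
  by exists i => //; have [walls _ _] := nd; have [clA _ _ _] := walls i; apply: clA; case: bi.
have [i iS _] := hit 0%N (leq0n M); have [i' i'S Ai] := hit 1%N M0.
have Si i2 : i2 \in S -> i2 = i by move=> i2S; apply: (card_le1_eqP S1).
rewrite (Si _ i'S) in Ai.
have J1 : J (c 1%N) by have [u [v []]] := col 1%N M0.
apply: (single_wall nd traj (cS 0%N M0) (col 0%N (leq0n M)) J1 Ai).
move=> t u v t01 bp; have [|i2 i2S ri] := only t u v _ bp; last by exists i2; rewrite //= (Si _ i2S).
by have /andP[-> /le_trans] := t01; apply; apply: cle; rewrite M0 leqnn.
Qed.

Lemma collision_boundS (n : nat) (eps : R) k N : (0 < n)%N -> (0 < k)%N ->
  collision_bound n eps k N -> exists N', collision_bound n eps k.+1 N'.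
Proof.
move=> n0 k0 IH.
pose D := 2 / sin (eps / 2) ^+ 2; pose x := 4 * D ^+ 2 + 4 * D.
(* As [b] exceeds [x], [few_blocks] fails for [k = b.+1], and [Q] is the number of blocks it takes
   for this [k]. Blocks of [N.+1] steps are nonempty even for [N = 0]. *)
pose b := Num.Def.archi_bound x; pose Q := (b.+3 + b.+4)%N.
exists (Q * N.+1)%N => m A J g S c M nd traj Sk cS col only.
rewrite ltnNge; apply/negP => QM.
have cle := increasing_prefix_le cS.
have clt i j : (i < j <= M)%N -> c i < c j.
  move=> /andP[ij jM]; apply: (@lt_le_trans _ _ (c i.+1)).
    by apply: cS; exact: leq_trans jM.
  by apply: cle; rewrite ij.
have [walls [p0 p0A] wide] := nd.
(* For fewer walls the bound [N] applies directly. Now [S] contains two different walls. *)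
have Sk1 : #|S| = k.+1.
  apply/eqP; rewrite eqn_leq Sk ltnNge; apply/negP => Sk'.
  have := IH m A J g S c M nd traj Sk' cS col only; apply/negP; rewrite -leqNgt.
  apply: leq_trans QM; apply: leq_trans (leqnSn N) _.
  by rewrite leq_pmull.
have [i1 [i2 [i1S i2S i12]]] : exists i1 i2, [/\ i1 \in S, i2 \in S & i1 != i2].
  by apply/card_gt1P; rewrite Sk1.
have inM j : (j <= Q)%N -> (j * N.+1 <= M)%N.
  by move=> jQ; apply: leq_trans QM; rewrite leq_mul2r jQ orbT.
have Jc j : (j <= M)%N -> J (c j) by move=> jM; have [u [v []]] := col j jM.
have cA i : segment_closed (A i) by have [_ /convex_set_segment] := walls i.
pose t j := c (j * N.+1)%N.
have t0M : c 0%N <= t 0%N by rewrite /t mul0n.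
have tQM : t Q <= c M by apply: cle; rewrite inM// leqnn.
have onlyt : collides_only A J g [set i | i \in S] (t 0%N) (t Q) := collides_onlyS t0M tQM only.
have J0 : J (t 0%N) by apply: Jc; rewrite mul0n.
have JQ : J (t Q) by apply: Jc; exact: inM.
have := @few_blocks R m 'I_n [set i | i \in S] A eps g t b.+1.
move=> /(_ _ _ _ _ _ isT) H.
suff : b%:R <= x by rewrite leNgt archi_boundP// /x !addr_ge0// !mulr_ge0// ?sqr_ge0// invr_ge0 sqr_ge0.
apply: H => //.
- by apply: closed_bigI => i _; have [] := walls i.
- by exists p0 => i _; exact: interior_subset.
- by apply: wide; exists i1.
- exact: wide_corner_angle nd.
- by move=> j jQ; apply: clt; rewrite ltn_mul2r ltnSn/= inM.
- exact: (nonexpanding_trajectory traj J0 JQ).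
- by move=> p Kp; exact: (comparison_trajectory walls traj J0 JQ onlyt Kp).
(* A block missing the wall [i] hits only the other [k] walls of [S]; its [N + 2] collision times,
   both ends included, contradict the bound [N]. *)
- move=> j i jQ iS; apply: contrapT => nvis.
  have jM r : (r <= N.+1)%N -> (j * N.+1 + r <= M)%N.
    move=> rN; apply: leq_trans (inM j.+1 jQ); by rewrite mulSn addnC leq_add2r.
  suff : (N.+1 < N)%N by rewrite ltnNge leqnSn.
  apply: (IH m A J g (S :\ i) (fun r => c (j * N.+1 + r)%N) N.+1 nd traj).
  + by move: Sk1; rewrite (cardsD1 i) iS add1n => -[->].
  + by move=> r rN; rewrite addnS; apply: cS; rewrite -addnS jM.
  + by move=> r rN; apply: col; exact: jM.
  + rewrite addn0 (addnC _ N.+1) -mulSn => s u v s01 bp.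
    have [|i' i'S ri] := onlyt s u v _ bp.
      have /andP[s0 s1] := s01; rewrite (le_trans _ s0) ?(le_trans s1)//.
        by apply: cle; rewrite inM// leq_mul2r jQ orbT.
      by apply: cle; rewrite mul0n leq0n inM// ltnW.
    exists i' => //=; rewrite in_setD1 (i'S : i' \in S) andbT; apply/eqP => i'i.
    apply: nvis; exists s => //; rewrite -i'i.
    by have [clA _ _ _] := walls i'; apply: clA; have [[]] := ri.
(* A point of [K] lies in [i1] and [i2] at once, whereas a trajectory meets at most one wall at a
   time. *)
- move=> j jQ Kt; have Jt := Jc _ (inM j jQ).
  have [d d0 one] := trajectory_one_wall traj Jt.
  have n0' : `|t j - t j| < d by rewrite subrr normr0.
  by case/eqP: i12; apply: (one _ _ _ _ Jt Jt n0' n0'); [exact: Kt i1S|exact: Kt i2S].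
Qed.

(** Induction starts at one wall, since the inductive step relies on two different walls being
    hit. *)
Lemma collision_bound_exists (n : nat) (eps : R) k : (0 < n)%N ->
  exists N, collision_bound n eps k N.
Proof.
move=> n0; case: k => [|k]; first by exists 0%N; exact: collision_bound0.
elim: k => [|k [N IH]]; first by exists 1%N; exact: collision_bound1.
exact: collision_boundS IH.
Qed.

End Counting.

Theorem mainTheorem2 (R : realType) (n : nat) (eps : R)
    (n_gt0 : (0 < n)%N) (eps_gt0 : 0 < eps) :
  exists N : nat,
    forall (m : nat) (A : 'I_n -> set 'rV[R]_m),
      (forall i, convex_wall (A i)) ->
      (exists p : 'rV[R]_m, forall i, interior (A i) p) ->
      (forall F : set 'I_n, F !=set0 ->
         wide_corners eps (\bigcap_(i in F) A i)) ->
      forall (J : set R) (g : R -> 'rV[R]_m),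
        billiard_trajectory A J g -> (collisions J g #<= `I_N)%card.
Proof.
have [N bound] := collision_bound_exists eps n n_gt0.
exists N => m A walls common wide J g traj; apply: contrapT.
(* More than [N] collisions give [N + 1] increasing collision times, for which [bound] with all
   walls allowed reads [N < N]. *)
move=> /increasing_enumeration[c [cS col]].
have : (N < N)%N; last by rewrite ltnn.
apply: (bound m A J g [set: 'I_n]%SET c N) => //; first by rewrite cardsT card_ord.
move=> t u v _ bp; have [i ri] := trajectory_reflection traj bp.
by exists i => //=; rewrite inE.
Qed.
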